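(* Let $\mathcal{C}$ be a category with finite products, $k$ a field, and $H^{\bullet} : \mathcal{C}^{\mathrm{op}} \to \mathbf{GrVec}_{k}$ a functor satisfying Axiom 1 (cup product), Axiom 2 (K\''unneth formula) and Axiom 3 (finite-dimensionality) stated in the context. Let $n \geq 1$, let $G$ be a subgroup of $S_n$, and suppose that the characteristic of $k$ does not divide $|G|$. Then for any object $X$ of $\mathcal{C}$ and any $k$-linear graded endomorphism $\phi = \bigoplus_{i\ge 0}\phi_i : H^{\bullet}(X) \to H^{\bullet}(X)$ (of degree $0$), $$L_{u}\left(\phi_{X^{n}}|_{H^{\bullet}(X^{n})^{G}}\right) = Z_{G}\left(L_{u}(\phi), L_{u^{2}}(\phi^{2}), \dots, L_{u^{n}}(\phi^{n})\right)$$ in $k[[u]]$, where $$Z_{G}(x_{1}, \dots, x_{n}) := \frac{1}{|G|}\sum_{g \in G}x_{1}^{m_{1}(g)} \cdots x_{n}^{m_{n}(g)} \in k[x_{1}, \dots, x_{n}]$$ and $m_{i}(g)$ is the number of $i$-cycles in the cycle decomposition of $g$ in $S_{n}$.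
   Context: $\mathbf{GrVec}_k$ is the category of $\mathbb{Z}_{\ge 0}$-graded $k$-vector spaces with $k$-linear graded maps of degree $0$. Write $H^\bullet(X) = \bigoplus_{i\geq 0} H^i(X)$, and $f^* : H^\bullet(Y) \to H^\bullet(X)$ for the map induced by a morphism $f : X \to Y$. Axiom 1: every object $X$ has a cup product, i.e. $k$-bilinear maps $\cup : H^i(X) \times H^j(X) \to H^{i+j}(X)$ for all $i,j \ge 0$ with $a \cup b = (-1)^{ij}\, b \cup a$ for $a \in H^i(X)$, $b \in H^j(X)$; the cup product is associative and natural, i.e. $f^*(a\cup b) = f^*(a)\cup f^*(b)$ for all morphisms $f$. Axiom 2 (K\''unneth formula): for all objects $X, Y$, with projections $p_X, p_Y$ from $X\times Y$, there is an isomorphism $H^\bullet(X \times Y) \simeq H^\bullet(X) \otimes_k H^\bullet(Y)$ given by $p_X^*(a) \cup p_Y^*(b) \mapsto a \otimes b$ for homogeneous $a, b$. Axiom 3: $H^i(X)$ is finite-dimensional over $k$ for every object $X$ and every $i$. These give $H^\bullet(X^n) \simeq H^\bullet(X)^{\otimes n}$ via $p_1^*(a_1) \cup \cdots \cup p_n^*(a_n) \mapsto a_1 \otimes \cdots \otimes a_n$, with $p_1,\dots,p_n : X^n \to X$ the projections. A subgroup $G \leqslant S_n$ acts on $X^n$ by permuting coordinates, and the induced linear action on $H^\bullet(X^n)$ is $g\cdot(p_1^*(a_1)\cup\cdots\cup p_n^*(a_n)) = p_{g(1)}^*(a_1)\cup\cdots\cup p_{g(n)}^*(a_n)$ for homogeneous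 $a_i$. $H^\bullet(X^n)^G$ is the graded subspace of $G$-invariants. A graded endomorphism $\phi$ of $H^\bullet(X)$ induces the graded endomorphism $\phi_{X^n}$ of $H^\bullet(X^n)$ given by $p_1^*(a_1)\cup\cdots\cup p_n^*(a_n) \mapsto p_1^*(\phi(a_1))\cup\cdots\cup p_n^*(\phi(a_n))$; it commutes with the $G$-action and so restricts to $\phi_{X^n}|_{H^\bullet(X^n)^G}$ on $H^\bullet(X^n)^G$. For a graded endomorphism $\psi = \bigoplus_i \psi_i$ of a graded vector space with finite-dimensional homogeneous pieces, the Lefschetz series is $L_u(\psi) := \sum_{i\geq 0}(-u)^i\,\mathrm{Tr}(\psi_i) \in k[[u]]$. Thus $L_{u^r}(\phi^r) = \sum_{i\ge 0}(-u^r)^i\,\mathrm{Tr}(\phi_i^r)$. *)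

(* Defs.v *)
From HB Require Import structures.
From mathcomp Require Import all_boot all_order all_algebra all_fingroup.
From mathcomp Require Import boolp.
From mathcomp Require Import mpoly.

Set Implicit Arguments.
Unset Strict Implicit.
Unset Printing Implicit Defensive.

Import GRing.Theory passmx.
Local Open Scope ring_scope.

(** * Formal power series *)

(* [Fps c] is the series with [c n] as coefficient of u^n.  It is a wrapper
   around [nat -> R], so that the product is the Cauchy product. *)
Record fps (R : Type) : Type := Fps { fps_coef : nat -> R }.
Arguments Fps {R}.

Lemma fpsP (R : Type) (f g : fps R) : fps_coef f =1 fps_coef g -> f = g.
Proof. by case: f g => [f] [g] /= /funext ->. Qed.

HB.instance Definition _ (R : Type) := gen_eqMixin (fps R).
HB.instance Definition _ (R : Type) := gen_choiceMixin (fps R).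

Section FpsRing.
Variable R : comNzRingType.
Implicit Types f g h : fps R.

Definition fps_zero : fps R := Fps (fun=> 0).
Definition fps_opp f : fps R := Fps (fun n => - fps_coef f n).
Definition fps_add f g : fps R := Fps (fun n => fps_coef f n + fps_coef g n).
Definition fpsC (c : R) : fps R := Fps (fun n => if n == 0%N then c else 0).
Definition fps_mul f g : fps R :=
  Fps (fun n => \sum_(i < n.+1) fps_coef f i * fps_coef g (n - i)).

Fact fps_addA : associative fps_add.
Proof. by move=> f g h; apply: fpsP => n /=; rewrite addrA. Qed.
Fact fps_addC : commutative fps_add.
Proof. by move=> f g; apply: fpsP => n /=; rewrite addrC. Qed.
Fact fps_add0 : left_id fps_zero fps_add.
Proof. by move=> f; apply: fpsP => n /=; rewrite add0r. Qed.
Fact fps_addN : left_inverse fps_zero fps_opp fps_add.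
Proof. by move=> f; apply: fpsP => n /=; rewrite addNr. Qed.

HB.instance Definition _ :=
  GRing.isZmodule.Build (fps R) fps_addA fps_addC fps_add0 fps_addN.

Let trunc n f : {poly R} := \poly_(i < n.+1) fps_coef f i.

Let coef_trunc_mul n m f g :
  (m <= n)%N -> (trunc n f * trunc n g)`_m = fps_coef (fps_mul f g) m.
Proof.
move=> le_mn; rewrite coefM /=; apply: eq_bigr => i _.
by rewrite !coef_poly !ltnS (leq_trans (leq_subr _ _) le_mn)
           (leq_trans _ le_mn) // -ltnS.
Qed.

Fact fps_mulA : associative fps_mul.
Proof.
move=> f g h; apply: fpsP => n.
have -> : fps_coef (fps_mul f (fps_mul g h)) n
          = (trunc n f * (trunc n g * trunc n h))`_n.
  rewrite coefM /=; apply: eq_bigr => i _.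
  by rewrite (coef_trunc_mul _ _ (leq_subr _ _)) coef_poly ltn_ord.
rewrite mulrA coefM /=; apply: eq_bigr => i _.
by rewrite (coef_trunc_mul _ _ (_ : i <= n)%N) ?leq_ord // coef_poly ltnS leq_subr.
Qed.

Fact fps_mulC : commutative fps_mul.
Proof.
move=> f g; apply: fpsP => n.
by rewrite -!(coef_trunc_mul _ _ (leqnn n)) mulrC.
Qed.

Fact fps_mul1 : left_id (fpsC 1) fps_mul.
Proof.
move=> f; apply: fpsP => n /=.
rewrite big_ord_recl /= mul1r subn0 big1 ?addr0 // => i _.
by rewrite mul0r.
Qed.

Fact fps_mulDl : left_distributive fps_mul fps_add.
Proof.
move=> f g h; apply: fpsP => n /=; rewrite -big_split /=.
by apply: eq_bigr => i _; rewrite mulrDl.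
Qed.

Fact fps_oner_neq0 : fpsC 1 != 0.
Proof.
apply/eqP => /(congr1 (fun f => fps_coef f 0%N)) /= /eqP.
by rewrite oner_eq0.
Qed.

HB.instance Definition _ := GRing.Zmodule_isComNzRing.Build (fps R)
  fps_mulA fps_mulC fps_mul1 fps_mulDl fps_oner_neq0.

Fact fpsC_is_zmod_morphism : zmod_morphism fpsC.
Proof.
by move=> a b; apply: fpsP => n /=; case: eqP => // _; rewrite subr0.
Qed.

Fact fpsC_is_monoid_morphism : monoid_morphism fpsC.
Proof.
split=> // a b; apply: fpsP => n /=.
rewrite big_ord_recl /= subn0 big1 ?addr0; last by move=> i _; rewrite mul0r.
by case: eqP => // _; rewrite mulr0.
Qed.

HB.instance Definition _ :=
  GRing.isZmodMorphism.Build R (fps R) fpsC fpsC_is_zmod_morphism.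
HB.instance Definition _ :=
  GRing.isMonoidMorphism.Build R (fps R) fpsC fpsC_is_monoid_morphism.

(* The series f(u^r), for r > 0. *)
Definition fps_subXn (r : nat) f : fps R :=
  Fps (fun n => if (r %| n)%N then fps_coef f (n %/ r) else 0).

End FpsRing.

Arguments fpsC {R} c.

(** * Cycle index *)

Definition cycle_count n (g : 'S_n) (i : nat) : nat :=
  #|[set c in porbits g | #|c| == i]|.

(* The variable x_i is 'X_(i-1), as ordinals start at 0. *)
Definition cycle_index (k : fieldType) n (G : {group 'S_n}) : {mpoly k[n]} :=
  (#|G|%:R)^-1 *: \sum_(g in G) \prod_(i < n) 'X_i ^+ cycle_count g i.+1.

(** * Graded vector spaces with finite-dimensional homogeneous pieces *)

Section Graded.
Variable k : fieldType.
Implicit Types V W : nat -> vectType k.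

Definition gr_end V := forall i, 'End(V i).

Definition gr_exp V (psi : gr_end V) (r : nat) : gr_end V :=
  fun i => iter r (fun f => (psi i \o f)%VF) \1%VF.

(* The restriction of [psi] to [U], provided that [U] is stable under [psi]. *)
Definition gr_restrict V (psi : gr_end V) (U : forall i, {vspace V i}) :
    gr_end (fun i => subvs_of (U i)) :=
  fun i => linfun (vsproj (U i) \o psi i \o vsval).

Definition lftrace (V : vectType k) (f : 'End(V)) : k :=
  \tr (mxof (vbasis {:V}) (vbasis {:V}) f).

Definition lefschetz V (psi : gr_end V) : fps k :=
  Fps (fun i => (-1) ^+ i * lftrace (psi i)).

(* A homogeneous element, together with its degree. *)
Definition helem V := {i : nat & V i}.
Definition hom_elem V i (a : V i) : helem V := Tagged (fun i => V i : Type) a.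

Definition hmap V W (f : forall i, 'Hom(V i, W i)) (x : helem V) : helem W :=
  hom_elem (f (tag x) (tagged x)).

(* The component of degree [l] of the homogeneous element [a] of degree [i]. *)
Definition hcomp V i (a : V i) (l : nat) : V l :=
  if @eqP _ i l is ReflectT e then ecast m (V m) e a else 0.

(** ** Tensor products *)

(* With (e_i) and (f_j) the bases [vbasis {:V}] and [vbasis {:W}], the matrix
   [delta_mx i j] stands for the tensor of e_i and f_j. *)
Definition tens (V W : vectType k) := 'M[k]_(\dim {:V}, \dim {:W}).
Definition tens_pure (V W : vectType k) (v : V) (w : W) : tens V W :=
  (rVof (vbasis {:V}) v)^T *m rVof (vbasis {:W}) w.

(* The piece of degree [d], i.e. the direct sum over i <= d of the tensor
   products of V_i and W_(d - i). *)
Definition gtens V W (d : nat) : Type :=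
  {dffun forall i : 'I_d.+1, tens (V i) (W (d - i)%N)}.

Section GtensModule.
Variables (V W : nat -> vectType k) (d : nat).
Implicit Types s t : gtens V W d.

HB.instance Definition _ := Choice.copy (gtens V W d)
  {dffun forall i : 'I_d.+1, tens (V i) (W (d - i)%N)}.

Definition gtens_zero : gtens V W d :=
  [ffun i : 'I_d.+1 => 0 : tens (V i) (W (d - i)%N)].
Definition gtens_opp s : gtens V W d :=
  [ffun i : 'I_d.+1 => - s i : tens (V i) (W (d - i)%N)].
Definition gtens_add s t : gtens V W d :=
  [ffun i : 'I_d.+1 => s i + t i : tens (V i) (W (d - i)%N)].
Definition gtens_scale (c : k) s : gtens V W d :=
  [ffun i : 'I_d.+1 => c *: s i : tens (V i) (W (d - i)%N)].

Fact gtens_addA : associative gtens_add.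
Proof. by move=> r s t; apply/ffunP => i; rewrite !ffunE addrA. Qed.
Fact gtens_addC : commutative gtens_add.
Proof. by move=> s t; apply/ffunP => i; rewrite !ffunE addrC. Qed.
Fact gtens_add0 : left_id gtens_zero gtens_add.
Proof. by move=> s; apply/ffunP => i; rewrite !ffunE add0r. Qed.
Fact gtens_addN : left_inverse gtens_zero gtens_opp gtens_add.
Proof. by move=> s; apply/ffunP => i; rewrite !ffunE addNr. Qed.

HB.instance Definition _ := GRing.isZmodule.Build (gtens V W d)
  gtens_addA gtens_addC gtens_add0 gtens_addN.

Fact gtens_scaleA a b s : gtens_scale a (gtens_scale b s) = gtens_scale (a * b) s.
Proof. by apply/ffunP => i; rewrite !ffunE scalerA. Qed.
Fact gtens_scale1 : left_id 1 gtens_scale.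
Proof. by move=> s; apply/ffunP => i; rewrite !ffunE scale1r. Qed.
Fact gtens_scaleDr : right_distributive gtens_scale +%R.
Proof. by move=> c s t; apply/ffunP => i; rewrite !ffunE scalerDr. Qed.
Fact gtens_scaleDl s : {morph gtens_scale^~ s : a b / a + b}.
Proof. by move=> a b; apply/ffunP => i; rewrite !ffunE scalerDl. Qed.

HB.instance Definition _ := GRing.Zmodule_isLmodule.Build k (gtens V W d)
  gtens_scaleA gtens_scale1 gtens_scaleDr gtens_scaleDl.

End GtensModule.

Definition gtens_pure V W i j (a : V i) (b : W j) : gtens V W (i + j) :=
  [ffun l : 'I_(i + j).+1 =>
     tens_pure (hcomp a l) (hcomp b (i + j - l)%N)
       : tens (V l) (W (i + j - l)%N)].

End Graded.

(** * Categories with finite products *)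

Record category := Category {
  obj :> Type;
  hom : obj -> obj -> Type;
  idm : forall X, hom X X;
  comp : forall X Y Z, hom Y Z -> hom X Y -> hom X Z;
  comp1m : forall X Y (f : hom X Y), comp (idm Y) f = f;
  compm1 : forall X Y (f : hom X Y), comp f (idm X) = f;
  compA : forall X Y Z T (h : hom Z T) (g : hom Y Z) (f : hom X Y),
    comp h (comp g f) = comp (comp h g) f
}.

Record product (C : category) (I : Type) (F : I -> C) := Product {
  prod_obj : C;
  proj : forall i, hom prod_obj (F i);
  tupling : forall Z : C, (forall i, hom Z (F i)) -> hom Z prod_obj;
  proj_tupling : forall (Z : C) (f : forall i, hom Z (F i)) i,
    comp (proj i) (tupling f) = f i;
  tupling_uniq : forall (Z : C) (h h' : hom Z prod_obj),
    (forall i, comp (proj i) h = comp (proj i) h') -> h = h'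
}.

Definition finite_products (C : category) :=
  forall (I : finType) (F : I -> C), product F.

Section Products.
Variables (C : category) (P : finite_products C).

Definition binprod (X Y : C) : product (fun b : bool => if b then X else Y) :=
  P (fun b : bool => if b then X else Y).
Definition proj1 (X Y : C) : hom (prod_obj (binprod X Y)) X :=
  proj (binprod X Y) true.
Definition proj2 (X Y : C) : hom (prod_obj (binprod X Y)) Y :=
  proj (binprod X Y) false.

Definition power (X : C) (n : nat) : product (fun _ : 'I_n => X) :=
  P (fun _ : 'I_n => X).

(* The automorphism s of X^n such that p_i s = p_(g i). *)
Definition perm_mor (X : C) n (g : 'S_n) :
    hom (prod_obj (power X n)) (prod_obj (power X n)) :=
  tupling (power X n) (fun i => proj (power X n) (g i)).

End Products.

(** * Cohomology theories *)

Record grfunctor (k : fieldType) (C : category) := GrFunctor {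
  coh :> C -> nat -> vectType k;
  pull : forall X Y : C, hom X Y -> forall i, 'Hom(coh Y i, coh X i);
  pull_id : forall (X : C) i, pull (idm X) i = \1%VF;
  pull_comp : forall (X Y Z : C) (g : hom Y Z) (f : hom X Y) i,
    pull (comp g f) i = (pull f i \o pull g i)%VF
}.

(* The degrees of the two sides of [cupC] and [cupA] agree only
   propositionally, hence equalities between elements with their degrees. *)
Record cup_product (k : fieldType) (C : category) (H : grfunctor k C) :=
  CupProduct {
  cup : forall (X : C) i j, H X i -> H X j -> H X (i + j)%N;
  cup_linearl : forall (X : C) i j (b : H X j),
    linear (fun a : H X i => cup a b);
  cup_linearr : forall (X : C) i j (a : H X i),
    linear (fun b : H X j => cup a b);
  cupC : forall (X : C) i j (a : H X i) (b : H X j),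
    hom_elem (cup a b) = hom_elem ((-1) ^+ (i * j) *: cup b a);
  cupA : forall (X : C) i j l (a : H X i) (b : H X j) (c : H X l),
    hom_elem (cup (cup a b) c) = hom_elem (cup a (cup b c));
  pull_cup : forall (X Y : C) (f : hom X Y) i j (a : H Y i) (b : H Y j),
    pull H f (i + j)%N (cup a b) = cup (pull H f i a) (pull H f j b)
}.

Section Cohomology.
Variables (k : fieldType) (C : category) (P : finite_products C).
Variables (H : grfunctor k C) (U : cup_product H).

Definition kunneth : Prop := forall X Y : C,
  exists K : forall d,
      {linear H (prod_obj (binprod P X Y)) d -> gtens (H X) (H Y) d},
    (forall d, bijective (K d)) /\
    (forall i j (a : H X i) (b : H Y j),
       K (i + j)%N (cup U (pull H (proj1 P X Y) i a) (pull H (proj2 P X Y) j b))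
       = gtens_pure a b).

Definition hcup (X : C) (x y : helem (H X)) : helem (H X) :=
  hom_elem (cup U (tagged x) (tagged y)).

(* The cup product of a nonempty sequence; as H(X) is not assumed to have a
   unit, the value on the empty sequence is arbitrary. *)
Definition hcups (X : C) (s : seq (helem (H X))) : helem (H X) :=
  if s is x :: s' then foldl (@hcup X) x s' else hom_elem (0 : H X 0%N).

(* p_1^*(a_1) cup ... cup p_n^*(a_n) *)
Definition cross (X : C) n (a : 'I_n -> helem (H X)) :
    helem (H (prod_obj (power P X n))) :=
  hcups [seq hmap (pull H (proj (power P X n) i)) (a i) | i <- enum 'I_n].

Definition invariants (X : C) n (G : {group 'S_n}) (d : nat) :
    {vspace H (prod_obj (power P X n)) d} :=
  (\bigcap_(g in G) fixedSpace (pull H (perm_mor P X g) d))%VS.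

Lemma lfun_ex (V W : vectType k) (f : V -> W) :
  linear f -> exists g : 'Hom(V, W), g =1 f.
Proof.
move=> flin; pose fl := HB.pack_for {linear V -> W} f
  (GRing.isSemilinear.Build k _ _ _ f (GRing.semilinear_linear flin)).
by exists (linfun fl) => v; rewrite lfunE.
Qed.

Lemma kunneth_end (HK : kunneth) (X Y : C)
    (phi : gr_end (H X)) (psi : gr_end (H Y)) :
  exists Theta : gr_end (H (prod_obj (binprod P X Y))),
    forall i j (a : H X i) (b : H Y j),
      Theta (i + j)%N
        (cup U (pull H (proj1 P X Y) i a) (pull H (proj2 P X Y) j b))
      = cup U (pull H (proj1 P X Y) i (phi i a))
              (pull H (proj2 P X Y) j (psi j b)).
Proof.
have [K [Kbij KE]] := HK X Y.
pose M (Z : vectType k) (f : 'End(Z)) :=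
  mxof (vbasis {:Z}) (vbasis {:Z}) f.
pose T d (t : gtens (H X) (H Y) d) : gtens (H X) (H Y) d :=
  [ffun i : 'I_d.+1 => (M _ (phi i))^T *m t i *m M _ (psi (d - i)%N)
     : tens (H X i) (H Y (d - i)%N)].
have Tlin d : linear (@T d).
  move=> c s t; apply/ffunP => i; rewrite !ffunE mulmxDr mulmxDl.
  by rewrite -scalemxAr -scalemxAl.
have hcompE (Z : C) (f : gr_end (H Z)) i (a : H Z i) l :
    hcomp (f i a) l = f l (hcomp a l).
  by rewrite /hcomp; case: eqP => [e|_]; [case: _ / e | rewrite linear0].
have Tpure i j (a : H X i) (b : H Y j) :
    T _ (gtens_pure a b) = gtens_pure (phi i a) (psi j b).
  apply/ffunP => l; rewrite !ffunE /tens_pure !hcompE.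
  rewrite !(rVof_app _ (vbasisP _)) trmx_mul /M.
  by rewrite !mulmxA.
have Theta_ex d : exists f : 'End(H (prod_obj (binprod P X Y)) d),
    forall v, K d (f v) = T d (K d v).
  have [Ki KKi KiK] := Kbij d.
  pose g v := Ki (T d (K d v)).
  have glin : linear g.
    move=> c u v; apply: (can_inj KKi).
    by rewrite linearP /g !KiK linearP Tlin.
  by have [h hE] := lfun_ex glin; exists h => v; rewrite hE /g KiK.
exists (fun d => sval (cid (Theta_ex d))) => i j a b.
by apply: (bij_inj (Kbij _)); rewrite (svalP (cid (Theta_ex _))) !KE Tpure.
Qed.

Lemma kunneth_span (HK : kunneth) (X Y : C)
    (S : forall d, {vspace H (prod_obj (binprod P X Y)) d}) :
  (forall i j (a : H X i) (b : H Y j),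
     cup U (pull H (proj1 P X Y) i a) (pull H (proj2 P X Y) j b)
       \in S (i + j)%N) ->
  forall d v, v \in S d.
Proof.
move=> Scup d v; have [K [Kbij KE]] := HK X Y.
have w_ex i j (eij : (i + j)%N = d) (a : H X i) (b : H Y j) :
    exists w, w \in S d /\ K d w = [ffun m : 'I_d.+1 =>
      tens_pure (hcomp a m) (hcomp b (d - m)%N) : tens (H X m) (H Y (d - m)%N)].
  by case: d / eij {v}; exists (cup U (pull H (proj1 P X Y) i a)
    (pull H (proj2 P X Y) j b)); rewrite KE.
have hcomp_id (Z : C) i (a : H Z i) : hcomp a i = a.
  by rewrite /hcomp; case: eqP => // e; rewrite (eq_axiomK e).
have hcomp_neq (Z : C) i l (a : H Z i) : i != l -> hcomp a l = 0.
  by rewrite /hcomp; case: eqP.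
have w'_ex (l : 'I_d.+1) (a : H X l) (b : H Y (d - l)%N) :=
  w_ex _ _ (subnKC (ltn_ord l : (l <= d)%N)) a b.
pose w l a b := sval (cid (w'_ex l a b)).
have wS l a b : w l a b \in S d by have [] := svalP (cid (w'_ex l a b)).
have wE l a b : K d (w l a b) = [ffun m : 'I_d.+1 =>
      tens_pure (hcomp a m) (hcomp b (d - m)%N) : tens (H X m) (H Y (d - m)%N)]
  by have [] := svalP (cid (w'_ex l a b)).
pose B (Z : vectType k) := vbasis {:Z}.
have -> : v = \sum_(l < d.+1) \sum_p \sum_q
    (K d v l p q) *: w l (B (H X l))`_p (B (H Y (d - l)%N))`_q.
  apply: (bij_inj (Kbij d)); rewrite linear_sum; apply/ffunP => m.
  have evD : {morph (fun s : gtens (H X) (H Y) d => s m) : s t / s + t}.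
    by move=> s t; rewrite ffunE.
  have ev0 : (0 : gtens (H X) (H Y) d) m = 0 by rewrite ffunE.
  rewrite (big_morph _ evD ev0) (bigD1 m) //= [X in _ + X]big1 ?addr0; last first.
    move=> l neq_lm; rewrite linear_sum (big_morph _ evD ev0) big1 // => p _.
    rewrite linear_sum (big_morph _ evD ev0) big1 // => q _.
    rewrite linearZ /= ffunE wE ffunE hcomp_neq // /tens_pure linear0 trmx0.
    by rewrite mul0mx scaler0.
  rewrite [LHS]matrix_sum_delta linear_sum (big_morph _ evD ev0).
  apply: eq_bigr => p _; rewrite linear_sum (big_morph _ evD ev0).
  apply: eq_bigr => q _; rewrite linearZ /= ffunE wE ffunE !hcomp_id /tens_pure.
  by rewrite !(rVofE (vbasisP _)) trmx_delta mul_delta_mx.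
by do 3!(apply: rpred_sum => ? _); apply: rpredZ.
Qed.

Lemma hmap_pull_comp (X Y Z : C) (g : hom Y Z) (f : hom X Y) (x : helem (H Z)) :
  hmap (pull H f) (hmap (pull H g) x) = hmap (pull H (comp g f)) x.
Proof. by rewrite /hmap /= pull_comp lfunE. Qed.

Lemma hmap_pull_hcup (X Y : C) (f : hom X Y) (x y : helem (H Y)) :
  hmap (pull H f) (hcup x y) = hcup (hmap (pull H f) x) (hmap (pull H f) y).
Proof. by rewrite /hmap /hcup /= pull_cup. Qed.

Lemma hmap_pull_hcups (X Y : C) (f : hom X Y) (s : seq (helem (H Y))) :
  hmap (pull H f) (hcups s) = hcups [seq hmap (pull H f) x | x <- s].
Proof.
case: s => [|x s] /=; first by rewrite /hmap /= linear0.
by elim: s x => //= y s IHs x; rewrite IHs hmap_pull_hcup.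
Qed.

Lemma pull_inv (X Y : C) (f : hom X Y) (g : hom Y X) :
  comp f g = idm Y -> forall i, cancel (pull H f i) (pull H g i).
Proof.
by move=> fg i v; rewrite -[LHS]comp_lfunE -pull_comp fg pull_id lfunE.
Qed.

Lemma cross1 (X : C) (a : 'I_1 -> helem (H X)) :
  cross a = hmap (pull H (proj (power P X 1) ord0)) (a ord0).
Proof. by rewrite /cross enum_ordSl enum_ord0. Qed.

Lemma power1_inv (X : C) : exists s : hom X (prod_obj (power P X 1)),
  comp (proj (power P X 1) ord0) s = idm X /\
  comp s (proj (power P X 1) ord0) = idm _.
Proof.
exists (tupling (power P X 1) (fun _ => idm X)).
split; first by rewrite proj_tupling.
by apply: tupling_uniq => i; rewrite compA proj_tupling comp1m compm1 [i]ord1.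
Qed.

Lemma cross_recr (X : C) n :
  let B := binprod P (prod_obj (power P X n.+1)) X in
  exists (e : hom (prod_obj (power P X n.+2)) (prod_obj B))
         (e' : hom (prod_obj B) (prod_obj (power P X n.+2))),
  [/\ comp e e' = idm _, comp e' e = idm _ &
      forall a : 'I_n.+2 -> helem (H X),
      cross a = hmap (pull H e)
        (hcup (hmap (pull H (proj1 P _ X)) (cross (fun i => a (lift ord_max i))))
              (hmap (pull H (proj2 P _ X)) (a ord_max)))].
Proof.
pose XQ := prod_obj (power P X n.+1); pose XN := prod_obj (power P X n.+2).
pose q : hom XN XQ := tupling (power P X n.+1)
  (fun i => proj (power P X n.+2) (lift ord_max i)).
pose r : hom XN X := proj (power P X n.+2) ord_max.
move=> B; pose e : hom XN (prod_obj B) := tupling B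
  (fun b => match b as b return hom XN (if b then XQ else X) with
            | true => q | false => r end).
pose e' : hom (prod_obj B) XN := tupling (power P X n.+2)
  (fun i => if unlift ord_max i is Some j
            then comp (proj (power P X n.+1) j) (proj1 P XQ X)
            else proj2 P XQ X).
have eq1 : comp (proj1 P XQ X) e = q by exact: (proj_tupling B _ true).
have eq2 : comp (proj2 P XQ X) e = r by exact: (proj_tupling B _ false).
have qe' : comp q e' = proj1 P XQ X.
  by apply: tupling_uniq => i; rewrite compA proj_tupling proj_tupling liftK.
have re' : comp r e' = proj2 P XQ X by rewrite proj_tupling unlift_none.
exists e, e'; split.
- apply: tupling_uniq => -[]; rewrite compm1 compA -/(proj1 P XQ X) -/(proj2 P XQ X).
    by rewrite eq1 qe'.
  by rewrite eq2 re'.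
- apply: tupling_uniq => i; rewrite compm1 compA proj_tupling.
  case: unliftP => [j ->|->]; last exact: eq2.
  by rewrite -compA eq1 proj_tupling.
move=> a; rewrite hmap_pull_hcup !hmap_pull_comp eq1 eq2.
rewrite /cross hmap_pull_hcups (enum_ordSr n.+1) map_rcons.
set s1 := [seq _ | i <- map _ _]; set s2 := map (hmap _) _.
have -> : s1 = s2.
  rewrite /s1 /s2 -!map_comp; apply: eq_map => i /=.
  rewrite hmap_pull_comp proj_tupling.
  have -> // : widen_ord (leqnSn n.+1) i = lift ord_max i.
  by apply: val_inj; rewrite /= /bump leqNgt ltn_ord.
have: s2 != [::] by rewrite /s2 enum_ordSl.
by case: s2 => //= y s _; rewrite foldl_rcons.
Qed.

Lemma power_end_exists (HK : kunneth) (X : C) n (n_gt0 : (0 < n)%N)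
    (phi : gr_end (H X)) :
  exists Phi : gr_end (H (prod_obj (power P X n))),
    forall a : 'I_n -> helem (H X),
      hmap Phi (cross a) = cross (fun i => hmap phi (a i)).
Proof.
case: n n_gt0 => // n _; elim: n => [|n [Phi PhiE]].
  have [s [ps _]] := power1_inv X.
  exists (fun d => pull H (proj (power P X 1) ord0) d \o phi d \o pull H s d)%VF.
  by move=> a; rewrite !cross1 /hmap /= !comp_lfunE (pull_inv ps).
have [e [e' [ee' _ crossE]]] := cross_recr X n.
have [Theta ThetaE] := kunneth_end HK Phi phi.
exists (fun d => pull H e d \o Theta d \o pull H e' d)%VF => a.
rewrite !crossE -PhiE /hmap /hcup /=; congr (hom_elem _).
by rewrite !comp_lfunE (pull_inv ee') ThetaE.
Qed.

Lemma cross_span (HK : kunneth) (X : C) n (n_gt0 : (0 < n)%N)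
    (S : forall d, {vspace H (prod_obj (power P X n)) d}) :
  (forall a : 'I_n -> helem (H X), tagged (cross a) \in S (tag (cross a))) ->
  forall d v, v \in S d.
Proof.
case: n n_gt0 S => // n _; elim: n => [|n IHn] S Scross d v.
  have [s [_ sp]] := power1_inv X.
  have := Scross (fun _ => hom_elem (pull H s d v)).
  by rewrite cross1 /= (pull_inv sp).
have [e [e' [_ e'e crossE]]] := cross_recr X n.
rewrite -[v](pull_inv e'e) memv_preim.
apply: (kunneth_span HK (S := fun d => (pull H e d @^-1: S d)%VS)) => i j y b.
have Lex m := lfun_ex (cup_linearl U
  (pull H (proj2 P (prod_obj (power P X n.+1)) X) j b) (i := m)).
pose L m := sval (cid (Lex m)).
have LE m z : L m z = cup U z (pull H (proj2 P _ X) j b).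
  exact: (svalP (cid (Lex m))).
pose L' m := (L m \o pull H (proj1 P _ X) m)%VF.
suff: y \in (L' i @^-1: (pull H e (i + j)%N @^-1: S (i + j)%N))%VS.
  by rewrite -!memv_preim comp_lfunE LE.
apply: (IHn (fun m => (L' m @^-1: (pull H e (m + j)%N @^-1: S (m + j)%N))%VS)).
move=> a; rewrite -2!memv_preim comp_lfunE LE.
pose a' i := if unlift ord_max i is Some l then a l else hom_elem b.
have := Scross a'; rewrite crossE /a' unlift_none.
suff -> : (fun i => a' (lift ord_max i)) = a by [].
by apply/funext => l; rewrite /a' liftK.
Qed.

Lemma power_end_uniq (HK : kunneth) (X : C) n (n_gt0 : (0 < n)%N)
    (Phi Psi : gr_end (H (prod_obj (power P X n)))) :
  (forall a : 'I_n -> helem (H X), hmap Phi (cross a) = hmap Psi (cross a)) ->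
  forall d, Phi d = Psi d.
Proof.
move=> eqPhi d; apply/lfunP => v; apply/eqP; rewrite -subr_eq0 -opp_lfunE -add_lfunE -memv_ker.
apply: (cross_span HK n_gt0 (S := fun d => lker (Phi d - Psi d))) => a.
rewrite memv_ker add_lfunE opp_lfunE subr_eq0; apply/eqP.
exact: (eq_from_Tagged (eqPhi a)).
Qed.

(* The endomorphism of H(X^n) induced by [phi]; it is characterized by
   [power_endP], according to [power_end_uniq]. *)
Definition power_end (HK : kunneth) (X : C) n (n_gt0 : (0 < n)%N)
    (phi : gr_end (H X)) : gr_end (H (prod_obj (power P X n))) :=
  sval (cid (power_end_exists HK n_gt0 phi)).

Lemma power_endP (HK : kunneth) (X : C) n (n_gt0 : (0 < n)%N)
    (phi : gr_end (H X)) (a : 'I_n -> helem (H X)) :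
  hmap (power_end HK n_gt0 phi) (cross a) = cross (fun i => hmap phi (a i)).
Proof. exact: (svalP (cid (power_end_exists HK n_gt0 phi))). Qed.

(* g . (p_1^*(a_1) cup ... cup p_n^*(a_n))
     = p_(g 1)^*(a_1) cup ... cup p_(g n)^*(a_n) *)
Lemma perm_mor_cross (X : C) n (g : 'S_n) (a : 'I_n -> helem (H X)) :
  hmap (pull H (perm_mor P X g)) (cross a)
  = hcups [seq hmap (pull H (proj (power P X n) (g i))) (a i) | i <- enum 'I_n].
Proof.
rewrite /cross hmap_pull_hcups -map_comp; congr hcups; apply: eq_map => i /=.
by rewrite hmap_pull_comp proj_tupling.
Qed.

End Cohomology.

(* Main.v *)
Require Import Defs.
From mathcomp Require Import all_boot all_order all_algebra all_fingroup.
From mathcomp Require Import boolp.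
From mathcomp Require Import mpoly.

Set Implicit Arguments.
Unset Strict Implicit.
Unset Printing Implicit Defensive.

Import GRing.Theory passmx.
Local Open Scope ring_scope.

(** Averaging over G projects H(X^n) onto the invariants, and Phi = phi_(X^n)
commutes with G; hence the trace of Phi on the invariants of degree d is the
mean over g in G of Tr(g Phi) ([lftrace_invariants]).  As Z_G is a mean over G
too, it suffices to show for a single g that the series of the
(-1)^d Tr(g Phi_d) is the product over the cycles c of g of
L_(u^|c|)(phi^|c|) ([lftrace_act_power_end]).

Choose a homogeneous basis of H(X).  The products e_f = p_1^*(b_(f 1)) cup ...
cup p_n^*(b_(f n)) span H(X^n), since the cross product is multilinear, and the
Kuenneth isomorphism provides the dual linear forms ([power_form_exists],
[cross_basis_expand]).  So Tr(g Phi_d) is the sum, over the f of total degree d,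
of the coefficient of e_f in g Phi(e_f), which is a Koszul sign times the
product over i of the coefficient of b_(f (g i)) in phi(b_(f i)).  It vanishes
unless the degree of f is constant on the cycles of g.

In that case the Koszul sign is the sign of the permutation that g induces on
the set S of the indices of odd degree ([koszul_stable]).  Together with the
factor (-1)^d, which equals (-1)^|S|, it amounts to one factor -1 for each
cycle contained in S ([sign_orbits]), i.e. to the product over the cycles c of
(-1)^(degree of f on c).  The signed sum over f therefore factors over the
cycles, and the factor of c is a sum over closed walks of length |c|, namely
the supertrace of phi^|c| ([sum_ffun_orbits]).  Keeping track of the degree of
b_j by u^(degree of b_j) turns this supertrace into L_(u^|c|)(phi^|c|)
([fps_coef_supertrace]).  Only the degrees up to d matter for the coefficient of
u^d, so that finite matrices over k[u] suffice throughout. *)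

(** * Signs of permutations preserving a labelling *)

Section Perm.
Variable T : finType.
Implicit Types (g : {perm T}) (S : {set T}).

(** A permutation that preserves [d] is a product of transpositions that
preserve [d]: if g moves x, then g composed with the transposition of x and g x
fixes x and everything that g fixes. *)
Lemma perm_ind_constant (A : Type) (d : T -> A) (Q : {perm T} -> Prop) :
    Q 1%g ->
    (forall g x y, x != y -> d x = d y -> (forall i, d (g i) = d i) ->
       Q g -> Q (g * tperm x y)%g) ->
  forall g, (forall i, d (g i) = d i) -> Q g.
Proof.
move=> Q1 Qmul g.
have [m] := ubnP #|[set i | g i != i]|; elim: m g => // m IHm g ltm dg.
have [g1 | [x gx]] : (forall i, g i = i) \/ exists x, g x != x.
  have [/existsP[x gx]|/existsPn gE] := boolP [exists x, g x != x].
    by right; exists x.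
  by left=> i; apply/eqP; have := gE i; rewrite negbK.
  have -> // : g = 1%g by apply/permP => i; rewrite g1 perm1.
have -> : g = ((g * tperm x (g x)) * tperm x (g x))%g.
  by rewrite -mulgA tperm2 mulg1.
have dg' i : d ((g * tperm x (g x))%g i) = d i.
  by rewrite permM; case: tpermP => [<-|/perm_inj<-|]; rewrite ?dg.
apply: Qmul => //; first by rewrite eq_sym.
apply: IHm => //; rewrite -ltnS; apply: leq_trans ltm; rewrite ltnS.
apply: proper_card; apply/properP; split.
  apply/subsetP => i; rewrite !inE; apply: contraNneq => gi.
  rewrite permM gi tpermD //; apply: contraNneq gx => xi; first by rewrite xi gi.
  by rewrite -(inj_eq (@perm_inj _ g)) xi gi.
by exists x; rewrite inE ?permM ?tpermR ?eqxx.
Qed.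

Lemma porbit_restr_perm S g x : g \in 'N(S | 'P)%g ->
  porbit (restr_perm S g) x = if x \in S then porbit g x else [set x].
Proof.
move=> gS.
have memS i y : (g ^+ i)%g y \in S = (y \in S).
  by have := astabs_act y (groupX i gS); rewrite /aperm.
have restrX i y : y \in S -> (restr_perm S g ^+ i)%g y = (g ^+ i)%g y.
  by move=> yS; rewrite -morphX // restr_permE // groupX.
case: ifP => xS; apply/setP => y.
  by apply/porbitP/porbitP => -[i ->]; exists i; rewrite restrX.
rewrite inE; apply/porbitP/eqP => [[i ->]|->]; last by exists 0%N; rewrite perm1.
by rewrite -morphX // (out_perm (restr_perm_on _ _)) // xS.
Qed.

Lemma porbit_sub S g x : g \in 'N(S | 'P)%g -> (porbit g x \subset S) = (x \in S).
Proof.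
move=> gS; apply/subsetP/idP => [->// | xS y /porbitP[i ->]]; first exact: porbit_id.
by have := astabs_act x (groupX i gS); rewrite /aperm /= => ->.
Qed.

Lemma card_porbits_restr_perm S g : g \in 'N(S | 'P)%g ->
  #|porbits (restr_perm S g)|
  = (#|[set c in porbits g | c \subset S]| + #|~: S|)%N.
Proof.
move=> gS; have -> : porbits (restr_perm S g)
    = [set c in porbits g | c \subset S] :|: [set [set x] | x in ~: S].
  apply/setP => c; rewrite !inE; apply/imsetP/orP.
    case=> x _ ->; rewrite porbit_restr_perm //; case: ifP => xS; [left|right].
      by rewrite imset_f // porbit_sub.
    by apply: imset_f; rewrite inE xS.
  case=> [/andP[/imsetP[x _ ->]] | /imsetP[x xS ->]].
    by rewrite porbit_sub // => xS; exists x; rewrite // porbit_restr_perm // xS.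
  by exists x => //; rewrite porbit_restr_perm //; move: xS; rewrite inE => /negbTE->.
rewrite cardsU (_ : _ :&: _ = set0) ?cards0 ?subn0.
  by rewrite (card_imset _ set1_inj).
apply/setP => c; rewrite !inE; apply/negP => /andP[/andP[_ /subsetP cS]].
case/imsetP => x xS cE; have := cS x; rewrite cE inE eqxx => /(_ isT).
by apply/negP; rewrite inE in xS.
Qed.

(** The sign of a permutation is the parity of the number of points minus the
number of orbits, and the points outside S count for as many orbits of
[restr_perm S g]. *)
Lemma sign_restr_perm (R : pzRingType) S g : g \in 'N(S | 'P)%g ->
  (-1) ^+ #|S| * (-1) ^+ restr_perm S g
  = (-1) ^+ #|[set c in porbits g | c \subset S]| :> R.
Proof.
move=> gS; rewrite /odd_perm card_porbits_restr_perm // -(cardsC S).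
rewrite !oddD addbACA addbb addbF signr_addb !signr_odd.
by rewrite mulrA -expr2 sqrr_sign mul1r.
Qed.

End Perm.

Lemma porbit_mem (T : finType) (g : {perm T}) c x : c \in porbits g -> x \in c -> porbit g x = c.
Proof. by case/imsetP => y _ ->; rewrite -eq_porbit_mem => /eqP. Qed.

(** Both factors on the left depend only on the set S of the points with an odd
label, which is a union of orbits; by [sign_restr_perm] their product counts the
orbits in S. *)
Lemma sign_orbits (R : comNzRingType) (T : finType) (d : T -> nat) (g : {perm T})
    (rep : {set T} -> T) :
    (forall i, d (g i) = d i) -> (forall c, c \in porbits g -> rep c \in c) ->
  (-1) ^+ (\sum_i d i) * (-1) ^+ restr_perm [set i | odd (d i)] g
  = \prod_(c in porbits g) (-1) ^+ d (rep c) :> R.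
Proof.
set S := [set i | odd (d i)] => dg repP.
have gS : g \in 'N(S | 'P)%g by apply/astabsP => i; rewrite !inE /= /aperm dg.
have signE m : (-1) ^+ m = if odd m then -1 else 1 :> R.
  by rewrite -signr_odd; case: odd.
have -> : (-1) ^+ (\sum_i d i) = (-1) ^+ #|S| :> R.
  rewrite -prodrXr -prodr_const [RHS]big_mkcond; apply: eq_bigr => i _.
  by rewrite inE signE.
rewrite sign_restr_perm // -prodr_const (eq_bigl _ _ (in_set _)) big_mkcondr.
apply: eq_bigr => c cg; rewrite signE.
have -> // : (c \subset S) = odd (d (rep c)).
by rewrite -{1}(porbit_mem cg (repP c cg)) porbit_sub // inE.
Qed.

(** * Sums over functions and traces of powers of a matrix *)

Section Partition.
Variables (R : comPzSemiRingType) (T J : finType).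

(** A function on [T] is a family of functions on the blocks of P; a function on
a block is represented by its extension by the constant [j0]. *)
Lemma sum_ffun_partition (P : {set {set T}}) (F : {set T} -> {ffun T -> J} -> R) (j0 : J) :
    partition P [set: T] ->
    (forall c (f h : {ffun T -> J}), c \in P -> {in c, f =1 h} -> F c f = F c h) ->
  \sum_(f : {ffun T -> J}) \prod_(c in P) F c f
  = \prod_(c in P) \sum_(f in pffun_on j0 c predT) F c f.
Proof.
move=> /and3P[/eqP covP trP _] Floc.
have memb x : pblock P x \in P by rewrite pblock_mem // covP inE.
have mem x : x \in pblock P x by rewrite mem_pblock covP inE.
have blk c x : c \in P -> x \in c -> pblock P x = c by move=> *; apply: def_pblock.
pose z : {ffun T -> J} := [ffun=> j0].
rewrite (big_distr_big_dep z) /=.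
pose cut (f : {ffun T -> J}) : {ffun {set T} -> {ffun T -> J}} :=
  [ffun c : {set T} => if c \in P then [ffun x => if x \in c then f x else j0] else z].
pose glue (h : {ffun {set T} -> {ffun T -> J}}) : {ffun T -> J} :=
  [ffun x => h (pblock P x) x].
rewrite (reindex_onto cut glue) /=.
  apply: eq_big => [f | f _].
    symmetry; apply/andP; split; last first.
      by apply/eqP/ffunP => x; rewrite !ffunE memb ffunE mem.
    apply/pfamilyP; split.
      by apply/subsetP => c; rewrite inE ffunE; case: ifP; rewrite ?eqxx.
    move=> c cP; apply/pffun_onP; split=> //.
    by apply/subsetP => x; rewrite inE ffunE cP ffunE; case: ifP; rewrite ?eqxx.
  by apply: eq_bigr => c cP; apply: Floc => // x xc; rewrite ffunE cP ffunE xc.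
move=> h /pfamilyP[/subsetP supp hP]; apply/ffunP => c; rewrite ffunE.
case: ifP => cP; last first.
  by apply/esym/eqP; apply: contraFT cP => hc; apply: supp; rewrite inE.
apply/ffunP => x; rewrite !ffunE; case: ifP => xc; first by rewrite (blk c).
have /pffun_onP[/subsetP sx _] := hP c cP.
by apply/esym/eqP; apply: contraFT xc => hx; apply: sx; rewrite inE.
Qed.

End Partition.

Section Walks.
Variables (R : comNzRingType) (m : nat) (M : 'M[R]_m).

Fixpoint walk_weight (a : 'I_m) (s : seq 'I_m) : R :=
  if s is b :: s' then M a b * walk_weight b s' else 1.

Lemma expmx_walks r a b :
  (M ^+ r) a b = \sum_(t : r.-tuple 'I_m | last a t == b) walk_weight a t.
Proof.
elim: r a => [|r IHr] a.
  rewrite expr0 mxE; case: eqP => [->|/eqP ab].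
    rewrite (big_pred1 [tuple]) // => t; rewrite tuple0 eqxx /= eqxx. by [].
  by rewrite big_pred0 // => t; rewrite tuple0 /= (negbTE ab).
rewrite exprS mxE.
rewrite (reindex (fun p : 'I_m * r.-tuple 'I_m => [tuple of p.1 :: p.2])) /=; last first.
  exists (fun t : r.+1.-tuple 'I_m => (thead t, [tuple of behead t])) => [[c t] _ | t _] /=.
    by rewrite theadE; congr pair; apply: val_inj.
  by rewrite -tuple_eta.
rewrite -(pair_big_dep xpredT (fun c (t : r.-tuple 'I_m) => last c t == b)
            (fun c t => M a c * walk_weight c t)) /=.
by apply: eq_bigr => c _; rewrite IHr mulr_sumr.
Qed.

Lemma walk_weight_traject (T : Type) (g : T -> T) (f : T -> 'I_m) x r :
  walk_weight (f x) [seq f i | i <- traject g (g x) r]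
  = \prod_(i <- traject g x r) M (f i) (f (g i)).
Proof.
by elim: r x => [|r IHr] x; rewrite ?big_nil //= big_cons IHr.
Qed.

End Walks.

(** Listing the points of [c] identifies the functions on [c] with tuples. *)
Lemma sum_pffun_tuple (R : nmodType) (T : finType) (J : finType) (j0 : J) (c : {set T})
    (s : seq T) (G : seq J -> R) :
  uniq s -> c =i s ->
  \sum_(f in pffun_on j0 c predT) G [seq f i | i <- s]
  = \sum_(t : (size s).-tuple J) G t.
Proof.
move=> s_uniq cs.
pose fn (t : (size s).-tuple J) : {ffun T -> J} :=
  [ffun i => if i \in c then nth j0 t (index i s) else j0].
pose tp (f : {ffun T -> J}) := [tuple of [seq f i | i <- in_tuple s]].
have fnE (t : (size s).-tuple J) l :
    (l < size s)%N -> nth j0 [seq fn t i | i <- s] l = nth j0 t l.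
  case: s s_uniq cs @fn @tp t => // y s' s_uniq cs fn tp t ls.
  by rewrite (nth_map y) // ffunE cs mem_nth // index_uniq.
have fnK t : [seq fn t i | i <- s] = t.
  apply: (@eq_from_nth _ j0); rewrite size_map ?size_tuple // => l ls.
  exact: fnE.
rewrite (reindex_onto fn tp) /=.
  apply: eq_big => [t | t _]; last by rewrite fnK.
  apply/andP; split; last by apply/eqP/val_inj; rewrite /= fnK.
  apply/pffun_onP; split=> //; apply/subsetP => i.
  by rewrite inE ffunE; case: ifP; rewrite ?eqxx.
move=> f /pffun_onP[/subsetP supp _]; apply/ffunP => i; rewrite ffunE.
case: ifP => ic; first by rewrite /= (nth_map i) ?index_mem -?cs // nth_index -?cs.
by apply/esym/eqP; apply: contraFT ic => fi; apply: supp; rewrite inE.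
Qed.

Lemma partition_porbits (T : finType) (g : {perm T}) : partition (porbits g) [set: T].
Proof.
apply/and3P; split.
- apply/eqP/setP => x; rewrite inE; apply/bigcupP.
  by exists (porbit g x); rewrite ?imset_f ?porbit_id.
- apply/trivIsetP => _ _ /imsetP[x _ ->] /imsetP[y _ ->].
  apply: contraNT => /pred0Pn[z /andP[]] /=.
  by rewrite -!eq_porbit_mem => /eqP<- /eqP<-.
by apply/imsetP => -[x _] /esym/eqP; rewrite -cards_eq0 (negbTE (card_porbit_neq0 g x)).
Qed.

Section Orbits.
Variables (R : comNzRingType) (T : finType) (m : nat) (M : 'M[R]_m) (w : 'I_m -> R).

(** Reading f along the orbit, from g x round to x, gives a walk of length
[#|porbit g x|] that starts and ends at f x. *)
Lemma sum_orbit (g : {perm T}) (x : T) (j0 : 'I_m) :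
  \sum_(f in pffun_on j0 (porbit g x) predT)
      w (f x) * \prod_(i in porbit g x) M (f i) (f (g i))
  = \sum_j w j * (M ^+ #|porbit g x|) j j.
Proof.
set r := #|porbit g x|; have r_gt0 : (0 < r)%N by rewrite lt0n card_porbit_neq0.
have sE : porbit g x =i traject g (g x) r.
  by have := porbit_traject g (g x); rewrite (porbit_perm g 1).
have s_uniq : uniq (traject g (g x) r).
  by have := uniq_traject_porbit g (g x); rewrite (porbit_perm g 1).
have last_s : last x (traject g (g x) r) = x.
  by rewrite last_traject iter_porbit.
transitivity (\sum_(f in pffun_on j0 (porbit g x) predT)
    (fun t => w (last j0 t) * walk_weight M (last j0 t) t)
       [seq f i | i <- traject g (g x) r]).
  apply: eq_bigr => f _.
  have -> : last j0 [seq f i | i <- traject g (g x) r] = f x.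
    by rewrite -[RHS](congr1 f last_s) -(last_map f) -(prednK r_gt0).
  rewrite walk_weight_traject big_uniq ?uniq_traject_porbit //=.
  by congr (_ * _); apply: eq_bigl => i; rewrite porbit_traject.
rewrite (sum_pffun_tuple _ (fun t => w (last j0 t) * walk_weight M (last j0 t) t)) //.
rewrite size_traject; under [RHS]eq_bigr do rewrite expmx_walks mulr_sumr.
rewrite (exchange_big_dep xpredT) //=; apply: eq_bigr => t _.
have lt a : last a t = last j0 t.
  by case: t => [[|b t]] //= /eqP sz; rewrite -sz in r_gt0.
by rewrite (big_pred1 (last j0 t)) // => j; rewrite lt eq_sym.
Qed.


Lemma sum_ffun_orbits (g : {perm T}) (x0 : T) (rep : {set T} -> T) :
    (forall c, c \in porbits g -> rep c \in c) ->
  \sum_(f : {ffun T -> 'I_m})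
      (\prod_(c in porbits g) w (f (rep c))) * \prod_i M (f i) (f (g i))
  = \prod_(c in porbits g) \sum_j w j * (M ^+ #|c|) j j.
Proof.
move=> repP.
have repE c : c \in porbits g -> porbit g (rep c) = c.
  by move=> cg; apply: porbit_mem (repP c cg).
have [j0 | m0] : 'I_m + (m = 0%N).
  by case: m => [|m']; [right | left; exact: ord0].
  have sum_c c : c \in porbits g -> \sum_j w j * (M ^+ #|c|) j j
      = \sum_(f in pffun_on j0 c predT)
          w (f (rep c)) * \prod_(i in c) M (f i) (f (g i)).
    by move=> cg; rewrite -[in LHS](repE c cg) -(sum_orbit _ _ j0) repE.
  rewrite (eq_bigr _ sum_c).
  have /and3P[/eqP covg trg _] := partition_porbits g.
  rewrite -(sum_ffun_partition (F := fun c (f : {ffun T -> 'I_m}) =>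
      w (f (rep c)) * \prod_(i in c) M (f i) (f (g i)))) ?partition_porbits //.
    apply: eq_bigr => f _; rewrite big_split -(big_trivIset _ trg) covg /=.
    by congr (_ * _); apply: eq_bigl => i; rewrite inE.
  move=> c f h cg fh; rewrite fh ?repP //; congr (_ * _); apply: eq_bigr => i ic.
  rewrite !fh //; move: ic; rewrite -(repE c cg) -!eq_porbit_mem => /eqP <-.
  by rewrite (porbit_perm g 1).
have ord_m (j : 'I_m) : false by case: j; rewrite m0.
rewrite [LHS]big_pred0; last by move=> f; have := ord_m (f x0).
rewrite (bigD1 (porbit g x0)) ?imset_f //= [X in X * _]big1 ?mul0r // => j _.
by have := ord_m j.
Qed.

End Orbits.

(** * Traces *)

Section Trace.
Variable k : fieldType.
Implicit Types V W : vectType k.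

Lemma lftraceE V (A : 'End(V)) :
  lftrace A = \sum_i coord (vbasis {:V}) i (A (vbasis {:V})`_i).
Proof.
rewrite /lftrace /mxtrace; apply: eq_bigr => i _.
have /rowP/(_ i) := rVof_app (vbasis {:V}) (vbasisP {:V}) A (vbasis {:V})`_i.
by rewrite (rVofE (vbasisP _)) -rowE !mxE.
Qed.

(** An endomorphism A is the sum of the rank one maps v |-> th_s(v) A(e_s), whose
traces are the th_s(A(e_s)). *)
Lemma lftrace_dual V (I : finType) (e : I -> V) (th : I -> 'Hom(V, k^o)) (A : 'End(V)) :
    (forall v, v = \sum_s th s v *: e s) ->
  lftrace A = \sum_s th s (A (e s)).
Proof.
move=> eK; rewrite lftraceE.
under eq_bigr => i _ do rewrite [(vbasis _)`_i]eK !linear_sum.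
rewrite exchange_big /=; apply: eq_bigr => s _.
rewrite [in RHS](coord_vbasis (memvf (A (e s)))) linear_sum.
by apply: eq_bigr => i _; rewrite !linearZ /= mulrC.
Qed.

Lemma lftrace_comm V W (f : 'Hom(V, W)) (g : 'Hom(W, V)) :
  lftrace (g \o f)%VF = lftrace (f \o g)%VF.
Proof. by rewrite /lftrace !(mxof_comp _ _ (vbasisP _)) mxtrace_mulC. Qed.

(** With i the inclusion of U and q : V -> U induced by Q, the restriction of A
is q A i, and i q = Q; the traces agree by [lftrace_comm]. *)
Lemma lftrace_restrict V (U : {vspace V}) (A Q : 'End(V)) :
    (forall v, Q v \in U) -> {in U, forall u, Q u = u} -> {in U, forall u, A u \in U} ->
  lftrace (linfun (vsproj U \o A \o vsval)) = lftrace (A \o Q)%VF.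
Proof.
move=> QU Qid AU; pose incl : 'Hom(subvs_of U, V) := linfun vsval.
pose rho : 'Hom(V, subvs_of U) := linfun (vsproj U \o Q).
have -> : (A \o Q)%VF = ((A \o incl) \o rho)%VF.
  by apply/lfunP => v; rewrite !comp_lfunE !lfunE /= vsprojK.
rewrite lftrace_comm; congr lftrace; apply/lfunP => u.
by rewrite !comp_lfunE !lfunE /= Qid // AU // subvsP.
Qed.

End Trace.

(** * Coefficients of power series *)

Lemma fps_coef_sum (R : comNzRingType) (I : Type) (s : seq I) (Q : pred I) (F : I -> fps R) d :
  fps_coef (\sum_(i <- s | Q i) F i) d = \sum_(i <- s | Q i) fps_coef (F i) d.
Proof. by elim/big_rec2: _ => //= i x y _ <-. Qed.

Lemma fps_coefCM (R : comNzRingType) (c : R) (F : fps R) d :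
  fps_coef (fpsC c * F) d = c * fps_coef F d.
Proof.
by rewrite /= big_ord_recl /= subn0 big1 ?addr0 // => i _; rewrite mul0r.
Qed.

Lemma fps_coef_prod (R : comNzRingType) (I : Type) (s : seq I) (Q : pred I)
    (F : I -> fps R) (p : I -> {poly R}) d :
    (forall i, Q i -> forall m, (m <= d)%N -> fps_coef (F i) m = (p i)`_m) ->
  forall m, (m <= d)%N ->
    fps_coef (\prod_(i <- s | Q i) F i) m = (\prod_(i <- s | Q i) p i)`_m.
Proof.
move=> Fp; elim/big_rec2: _ => [m _ | i x y Qi IH m md]; first by rewrite coef1 /=; case: m.
rewrite coefM /=; apply: eq_bigr => j _.
rewrite Fp ?IH // ?(leq_trans (leq_subr _ _)) //.
by rewrite (leq_trans _ md) // -ltnS.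
Qed.

(** Grouping the cycles of g by their length turns the monomials of the cycle
index into products over cycles. *)
Lemma mmap_cycle_index (k : fieldType) n (G : {group 'S_n}) (h : nat -> fps k) :
  mmap (@fpsC k) (fun i : 'I_n => h i.+1) (cycle_index k G)
  = fpsC (#|G|%:R^-1) * \sum_(g in G) \prod_(c in porbits g) h #|c|.
Proof.
rewrite /cycle_index mmapZ rmorph_sum /=; congr (_ * _).
apply: eq_bigr => g _; rewrite rmorph_prod /=.
transitivity (\prod_(i < n) \prod_(c in porbits g | #|c| == i.+1) h #|c|).
  apply: eq_bigr => i _; rewrite rmorphXn /= mmapX mmap1U.
  rewrite -prodr_const; apply: eq_big => [c | c]; first by rewrite inE.
  by rewrite inE => /andP[_ /eqP->].
rewrite (exchange_big_dep [pred c | c \in porbits g]) /=; last by move=> ? ? _ /andP[].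
apply: eq_bigr => c cg.
have c_gt0 : (0 < #|c|)%N.
  by case/imsetP: cg => x _ ->; rewrite lt0n card_porbit_neq0.
have c_le : (#|c|.-1 < n)%N by rewrite prednK // -[n in (_ <= n)%N]card_ord max_card.
rewrite (big_pred1 (Ordinal c_le)) // => i.
by rewrite cg /= -[#|c| in LHS](prednK c_gt0) eqSS eq_sym.
Qed.

(** * Homogeneous bases *)

Section Homogeneous.
Variable k : fieldType.
Implicit Types V W : nat -> vectType k.

Definition gr_form V := forall i, 'Hom(V i, k^o).

Definition hform V (th : gr_form V) (x : helem V) : k := th (tag x) (tagged x).

Lemma hcomp_id V i (a : V i) : hcomp a i = a.
Proof. by rewrite /hcomp; case: eqP => // e; rewrite (eq_axiomK e). Qed.

Lemma hcomp_neq V i l (a : V i) : i != l -> hcomp a l = 0.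
Proof. by rewrite /hcomp; case: eqP. Qed.

Lemma hcomp_linear V i l : linear (fun a : V i => hcomp a l).
Proof.
move=> c a b; have [<-|il] := eqVneq i l; first by rewrite !hcomp_id.
by rewrite !hcomp_neq // scaler0 addr0.
Qed.

Lemma hcomp_map V W (f : forall i, 'Hom(V i, W i)) i (a : V i) l :
  hcomp (f i a) l = f l (hcomp a l).
Proof.
by have [<-|il] := eqVneq i l; rewrite ?hcomp_id // !hcomp_neq // linear0.
Qed.

Lemma hform_hcomp V (th : gr_form V) (x : helem V) m :
  tag x = m -> hform th x = th m (hcomp (tagged x) m).
Proof. by case: x => i a /= <-; rewrite hcomp_id. Qed.

Variables (V : nat -> vectType k) (d : nat).

(** Cut off in degree [d], in order to be a finite type. *)
Definition basis_index : finType := {i : 'I_d.+1 & 'I_(\dim {:V i})}.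
Local Notation J := 'I_#|basis_index|.

Definition idx_deg (p : J) : nat := tag (enum_val p).

Definition basis_elem (p : J) : helem V :=
  hom_elem (vbasis {:V (idx_deg p)})`_(tagged (enum_val p)).

Lemma dual_form_exists (p : J) : exists th : gr_form V,
  forall i (a : V i), th i a
    = coord (vbasis {:V (idx_deg p)}) (tagged (enum_val p)) (hcomp a (idx_deg p)).
Proof.
have th_ex i : exists t : 'Hom(V i, k^o),
    t =1 fun a => coord (vbasis {:V (idx_deg p)}) (tagged (enum_val p)) (hcomp a (idx_deg p)).
  by apply: lfun_ex => c a b; rewrite hcomp_linear linearP.
by exists (fun i => sval (cid (th_ex i))) => i a; rewrite (svalP (cid (th_ex i))).
Qed.

Definition dual_form (p : J) : gr_form V := sval (cid (dual_form_exists p)).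

Lemma dual_formE p i (a : V i) :
  dual_form p i a = coord (vbasis {:V (idx_deg p)}) (tagged (enum_val p)) (hcomp a (idx_deg p)).
Proof. exact: (svalP (cid (dual_form_exists p))). Qed.

Lemma dual_form_deg p x : tag x != idx_deg p -> hform (dual_form p) x = 0.
Proof. by move=> xp; rewrite /hform dual_formE hcomp_neq ?linear0. Qed.

Lemma dual_form_basis p q : hform (dual_form p) (basis_elem q) = (p == q)%:R.
Proof.
rewrite /hform dual_formE /= /basis_elem /idx_deg -(inj_eq enum_val_inj).
case: (enum_val p) (enum_val q) => [i a] [j b] /=.
have [ij | ij] := eqVneq i j; last first.
  rewrite hcomp_neq; last by rewrite val_eqE eq_sym.
  by rewrite linear0; case: eqP => // /(congr1 tag) /= e; rewrite e eqxx in ij.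
case: j / ij b => b; rewrite hcomp_id coord_free ?(basis_free (vbasisP _)) //.
by rewrite eq_Tagged /= eq_sym.
Qed.

Lemma dual_form_expand (m : 'I_d.+1) (v : V m) :
  v = \sum_p dual_form p m v *: hcomp (tagged (basis_elem p)) m.
Proof.
pose F (s : basis_index) : V m := coord (vbasis {:V (tag s)}) (tagged s) (hcomp v (tag s))
   *: hcomp (vbasis {:V (tag s)})`_(tagged s) m.
rewrite (eq_bigr (fun p => F (enum_val p))); last by move=> p _; rewrite dual_formE.
rewrite -(big_enum_val F) /=.
transitivity (\sum_(i < d.+1) \sum_(a < \dim {:V i}) F (Tagged _ a)); last first.
  by rewrite sig_big_dep; apply: eq_bigr => -[i a].
rewrite (bigD1 m) //= [X in _ + X]big1 ?addr0 => [|i im]; last first.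
  by apply: big1 => a _; rewrite /F /= (hcomp_neq (l := m)) ?scaler0.
rewrite [LHS](coord_vbasis (memvf v)); apply: eq_bigr => a _.
by rewrite /F /= !hcomp_id.
Qed.

Definition gr_coef (phi : gr_end V) (p q : J) : k :=
  hform (dual_form q) (hmap phi (basis_elem p)).

Lemma gr_coef_deg phi p q : idx_deg p != idx_deg q -> gr_coef phi p q = 0.
Proof. by move=> pq; rewrite /gr_coef dual_form_deg. Qed.

(** Row convention: [gr_coef phi p q] is the coefficient of the q-th basis
element in the image of the p-th one, so that matrices compose in the order in
which the maps are applied. *)
Lemma gr_coef_comp phi psi p q :
  \sum_s gr_coef phi p s * gr_coef psi s q = gr_coef (fun i => psi i \o phi i)%VF p q.
Proof.
pose m := tag (enum_val p).
rewrite /gr_coef [RHS]/hform /= comp_lfunE.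
rewrite [in RHS](@dual_form_expand m (phi _ _)) !linear_sum; apply: eq_bigr => s _.
rewrite !linearZ /=.
have [ms|ms] := eqVneq (idx_deg s) m; last first.
  rewrite dual_form_deg ?mul0r; last by rewrite eq_sym.
  by rewrite [X in X *: _](@dual_form_deg s (hmap phi (basis_elem p))) ?scale0r // eq_sym.
by rewrite -hcomp_map (hform_hcomp _ (x := hmap psi (basis_elem s)) ms).
Qed.

Lemma lftrace_gr_coef (phi : gr_end V) (i : 'I_d.+1) :
  lftrace (phi i) = \sum_(p | idx_deg p == i) gr_coef phi p p.
Proof.
rewrite (lftrace_dual _ (@dual_form_expand i)) [RHS]big_mkcond; apply: eq_bigr => p _.
case: eqP => [<-|/eqP pi]; first by rewrite hcomp_id.
by rewrite hcomp_neq // !linear0.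
Qed.

(** A factor u^i in each entry of degree i, so that the r-th power carries the
factor u^(r i), as in L_(u^r). *)
Definition coef_mx (phi : gr_end V) : 'M[{poly k}]_#|basis_index| :=
  \matrix_(p, q) ((gr_coef phi p q)%:P * 'X^(idx_deg p)).

Lemma coef_mxX (phi : gr_end V) r p q :
  (coef_mx phi ^+ r) p q = (gr_coef (gr_exp phi r) p q)%:P * 'X^(r * idx_deg p).
Proof.
elim: r q => [|r IHr] q.
  rewrite expr0 mxE mul0n expr0 mulr1 /gr_coef.
  have -> : hmap (gr_exp phi 0) (basis_elem p) = basis_elem p.
    by rewrite /hmap /= id_lfunE.
  by rewrite dual_form_basis eq_sym; case: eqP.
rewrite exprSr mxE -[gr_exp phi r.+1]/(fun i => (phi i \o gr_exp phi r i)%VF).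
rewrite -gr_coef_comp rmorph_sum mulr_suml; apply: eq_bigr => s _ /=.
rewrite IHr !mxE polyCM.
have [ps|ps] := eqVneq (idx_deg p) (idx_deg s).
  by rewrite -ps mulSn addnC exprD mulrACA.
by rewrite gr_coef_deg // !mul0r.
Qed.

(** The entries of degree i on the diagonal of [coef_mx phi ^+ r] add up to
Tr(phi_i^r) u^(r i), so the supertrace is L_(u^r)(phi^r) up to degree d. *)
Lemma fps_coef_supertrace (phi : gr_end V) r m : (0 < r)%N -> (m <= d)%N ->
  fps_coef (fps_subXn r (lefschetz (gr_exp phi r))) m
  = (\sum_p (-1) ^+ idx_deg p * (coef_mx phi ^+ r) p p)`_m.
Proof.
move=> r_gt0 md; rewrite coef_sum.
have termE p : ((-1) ^+ idx_deg p * (coef_mx phi ^+ r) p p)`_m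
    = if m == (r * idx_deg p)%N
      then (-1) ^+ idx_deg p * gr_coef (gr_exp phi r) p p else 0.
  rewrite coef_mxX -(rmorph_sign (@polyC k)) /= !coefCM coefXn.
  by case: eqP; rewrite ?mulr1 ?mulr0.
rewrite (eq_bigr _ (fun p _ => termE p)) /=; case: dvdnP => [[i mE]|ndiv]; last first.
  by rewrite big1 // => p _; case: eqP => // mE; case: ndiv; exists (idx_deg p); rewrite mulnC.
have id : (i < d.+1)%N by rewrite ltnS (leq_trans _ md) // mE leq_pmulr.
rewrite mE mulnK // -[i]/(val (Ordinal id)) lftrace_gr_coef mulr_sumr big_mkcond.
apply: eq_bigr => p _; rewrite /= [(r * _)%N]mulnC eqn_pmul2r // [i == _]eq_sym.
by case: eqP => // <-.
Qed.

End Homogeneous.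

(** * Graded cup products *)

Section HomogeneousOperations.
Variable k : fieldType.
Implicit Types V W : nat -> vectType k.

Definition hscale V (c : k) (x : helem V) : helem V := hom_elem (c *: tagged x).

Lemma hscale1 V (x : helem V) : hscale 1 x = x.
Proof. by case: x => i a; rewrite /hscale /= scale1r. Qed.

Lemma hscaleA V b c (x : helem V) : hscale b (hscale c x) = hscale (b * c) x.
Proof. by rewrite /hscale /= scalerA. Qed.

Lemma hmap_scale V W (f : forall i, 'Hom(V i, W i)) c x :
  hmap f (hscale c x) = hscale c (hmap f x).
Proof. by rewrite /hmap /hscale /= linearZ. Qed.

Lemma hmap_comp V1 V2 V3 (f : forall i, 'Hom(V2 i, V3 i)) (g : forall i, 'Hom(V1 i, V2 i)) x :
  hmap (fun i => f i \o g i)%VF x = hmap f (hmap g x).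
Proof. by rewrite /hmap /= comp_lfunE. Qed.

Lemma hform_scale V (th : gr_form V) c x : hform th (hscale c x) = c * hform th x.
Proof. by rewrite /hform /hscale /= linearZ. Qed.

End HomogeneousOperations.

Section Cup.
Variables (k : fieldType) (C : category) (H : grfunctor k C) (U : cup_product H).
Variable X : C.
Implicit Types (x y z : helem (H X)) (s t : seq (helem (H X))).

Lemma cup_lfunl i j (b : H X j) : exists L : 'Hom(H X i, H X (i + j)%N), forall a, L a = cup U a b.
Proof. exact: lfun_ex (cup_linearl U b). Qed.

Lemma cup_lfunr i j (a : H X i) : exists L : 'Hom(H X j, H X (i + j)%N), forall b, L b = cup U a b.
Proof. exact: lfun_ex (cup_linearr U a). Qed.

Lemma hcup_scalel c x y : hcup U (hscale c x) y = hscale c (hcup U x y).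
Proof.
have [L LE] := cup_lfunl (tag x) (tagged y).
by rewrite /hcup /hscale /= -!LE linearZ.
Qed.

Lemma hcupC x y : hcup U x y = hscale ((-1) ^+ (tag x * tag y)) (hcup U y x).
Proof. by rewrite /hcup cupC. Qed.

Lemma hcupA x y z : hcup U (hcup U x y) z = hcup U x (hcup U y z).
Proof. by rewrite /hcup cupA. Qed.

Lemma hcups_cat s t : s != [::] -> t != [::] ->
  hcups U (s ++ t) = hcup U (hcups U s) (hcups U t).
Proof.
case: s t => // x s [] // y t _ _ /=; rewrite foldl_cat /=.
by elim: t y => //= z t IHt y; rewrite hcupA IHt.
Qed.

Lemma tag_hcups s : tag (hcups U s) = sumn [seq tag x | x <- s].
Proof.
case: s => //= x s; elim: s x => [|y s IHs] x /=; first by rewrite addn0.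
by rewrite IHs /= addnA.
Qed.

(** Graded commutativity for two consecutive blocks, which have the sums of the
degrees of their entries as degrees. *)
Lemma hcups_swap s t r :
  hcups U (s ++ t ++ r)
  = hscale ((-1) ^+ (sumn [seq tag x | x <- s] * sumn [seq tag x | x <- t]))
      (hcups U (t ++ s ++ r)).
Proof.
case: (eqVneq s [::]) => [->|s0]; first by rewrite hscale1.
case: (eqVneq t [::]) => [->|t0]; first by rewrite /= muln0 hscale1.
have st0 (u v : seq (helem (H X))) : u != [::] -> u ++ v != [::] by case: u.
have swap : hcups U (s ++ t) = hscale ((-1) ^+ (sumn [seq tag x | x <- s] *
    sumn [seq tag x | x <- t])) (hcups U (t ++ s)).
  by rewrite !hcups_cat // hcupC !tag_hcups.
case: (eqVneq r [::]) => [->|r0]; first by rewrite !cats0.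
by rewrite !catA !(hcups_cat (t := r)) ?st0 // swap hcup_scalel.
Qed.

(** The sign depends only on the degrees.  Any rearrangement is a composite of
exchanges of consecutive blocks, so [hcups_swap] produces such a sign. *)
Lemma hcups_perm (I : eqType) (d : I -> nat) (l l' : seq I) : perm_eq l l' ->
  exists b : bool, forall y : I -> helem (H X), (forall i, tag (y i) = d i) ->
    hcups U (map y l') = hscale ((-1) ^+ b) (hcups U (map y l)).
Proof.
move=> pll'; pose Q r := exists b : bool, forall y : I -> helem (H X),
  (forall i, tag (y i) = d i) ->
  hcups U (map y r) = hscale ((-1) ^+ b) (hcups U (map y l)).
suff swapQ (s t r : seq I) : Q (s ++ t ++ r) -> Q (t ++ s ++ r).
  by apply: (catCA_perm_ind (P := Q) swapQ pll'); exists false => y _; rewrite hscale1.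
case=> b IHb; exists (odd (sumn (map d s) * sumn (map d t)) (+) b) => y yd.
rewrite !map_cat hcups_swap -!map_cat IHb // hscaleA signr_addb signr_odd.
rewrite -!map_comp !(eq_map (_ : tag \o y =1 d)) //.
by rewrite [(sumn _ * _)%N]mulnC.
Qed.

(** [(-1) ^+ b] is the Koszul sign of the permutation g of n factors, the one in
position i having degree [d i]. *)
Definition koszul n (d : 'I_n -> nat) (g : 'S_n) (b : bool) :=
  forall y : 'I_n -> helem (H X), (forall i, tag (y i) = d i) ->
    hcups U [seq y (g i) | i <- enum 'I_n]
    = hscale ((-1) ^+ b) (hcups U [seq y i | i <- enum 'I_n]).

Lemma koszul_exists n (d : 'I_n -> nat) g : exists b, koszul d g b.
Proof.
have [|b bP] := @hcups_perm _ d (enum 'I_n) (map g (enum 'I_n)).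
  apply: uniq_perm; rewrite ?enum_uniq ?(map_inj_uniq (@perm_inj _ g)) ?enum_uniq //.
  move=> i; rewrite mem_enum; apply/esym/mapP.
  by exists (g^-1%g i); rewrite ?mem_enum ?permKV.
by exists b => y yd; rewrite -bP //; congr (hcups U _); exact: map_comp.
Qed.

(** As g preserves the degrees, the factors in the order given by g have the
same degrees, position by position, as the original ones; so the sign of h is
the same for both orders. *)
Lemma koszul_mul n (d : 'I_n -> nat) (g h : 'S_n) b c : (forall i, d (g i) = d i) ->
  koszul d g b -> koszul d h c -> koszul d (h * g)%g (b (+) c).
Proof.
move=> dg gb hc y yd; rewrite signr_addb mulrC -hscaleA -gb //.
rewrite -hc => [|i]; last by rewrite yd dg.
by congr (hcups U _); apply: eq_map => i; rewrite permM.
Qed.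

(** Rearrange the factors so that those at x and y come first.  As these two have
the same degree, the sign of this rearrangement is the same before and after
the exchange, and cancels; the exchange of two neighbours of degree m
contributes (-1)^(m m). *)
Lemma koszul_tperm n (d : 'I_n -> nat) (x y : 'I_n) : x != y -> d x = d y ->
  koszul d (tperm x y) (odd (d x)).
Proof.
move=> xy dxy; pose l := rem y (rem x (enum 'I_n)).
have lP : perm_eq (enum 'I_n) (x :: y :: l).
  apply: (perm_trans (perm_to_rem (_ : x \in _))); rewrite ?mem_enum // perm_cons.
  by apply: perm_to_rem; rewrite mem_rem_uniq ?enum_uniq // inE eq_sym xy mem_enum.
have [b bP] := hcups_perm d lP; move=> z zd.
have zdt i : tag (z (tperm x y i)) = d i.
  by rewrite zd; case: tpermP => // ->.
have sgn2 : (-1) ^+ b * (-1) ^+ b = 1 :> k by rewrite -expr2 sqrr_sign.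
have bP' (u : 'I_n -> helem (H X)) : (forall i, tag (u i) = d i) -> hcups U (map u (enum 'I_n)) =
    hscale ((-1) ^+ b) (hcups U (map u [:: x, y & l])).
  by move=> ud; rewrite (bP u ud) hscaleA sgn2 hscale1.
rewrite (bP' (fun i => z (tperm x y i))) // (bP' z) //= tpermL tpermR.
have -> : [seq z (tperm x y i) | i <- l] = map z l.
  apply/eq_in_map => i; have un := enum_uniq 'I_n.
  rewrite mem_rem_uniq ?rem_uniq // inE => /andP[iy].
  rewrite mem_rem_uniq // inE => /andP[ix _].
  by rewrite tpermD // eq_sym.
have /= -> := hcups_swap [:: z y] [:: z x] (map z l).
rewrite !hscaleA; congr hscale; rewrite mulrC; congr (_ * _).
by rewrite !addn0 !zd -dxy -signr_odd oddM andbb.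
Qed.

(** Both sides are multiplicative in g, so it is enough to compare them on
transpositions, according to [perm_ind_constant]. *)
Lemma koszul_stable n (d : 'I_n -> nat) (g : 'S_n) : (forall i, d (g i) = d i) ->
  koszul d g (restr_perm [set i | odd (d i)] g).
Proof.
set S := [set i | odd (d i)].
have stS (h : 'S_n) : (forall i, d (h i) = d i) -> h \in 'N(S | 'P)%g.
  by move=> dh; apply/astabsP => i; rewrite !inE /= /aperm dh.
apply: (perm_ind_constant (d := d) (Q := fun g => koszul d g (restr_perm S g))).
  move=> y _; rewrite morph1 odd_perm1 hscale1; congr (hcups U _).
  by apply: eq_map => i; rewrite perm1.
move=> h x y xy dxy dh hh.
have dt i : d (tperm x y i) = d i by case: tpermP => // ->.
rewrite morphM ?stS // odd_permM addbC.
apply: koszul_mul => //.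
have -> : restr_perm S (tperm x y) = odd (d x) :> bool; last exact: koszul_tperm.
have [xS|xS] := boolP (x \in S).
  have -> : restr_perm S (tperm x y) = tperm x y.
    apply/permP => i; have [iS|iS] := boolP (i \in S).
      by rewrite restr_permE ?stS.
    rewrite (out_perm (restr_perm_on _ _)) // tpermD //; apply: contraNneq iS => <- //.
    by rewrite inE -dxy; rewrite inE in xS.
  by rewrite odd_tperm xy; rewrite inE in xS; rewrite xS.
have -> : restr_perm S (tperm x y) = 1%g.
  apply/permP => i; rewrite perm1; have [iS|iS] := boolP (i \in S).
    rewrite restr_permE ?stS // tpermD //; apply: contraNneq xS => xyi.
      by rewrite xyi.
    by rewrite inE dxy xyi; rewrite inE in iS.
  by rewrite (out_perm (restr_perm_on _ _)).
by rewrite odd_perm1; rewrite inE in xS; rewrite (negbTE xS).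
Qed.

(** The degree of the product is hidden in [e] because it equals the sum of the
degrees of the factors only propositionally. *)
Lemma hcups_lfun s t i : exists e (L : 'Hom(H X i, H X e)),
  forall v, hcups U (s ++ hom_elem v :: t) = hom_elem (L v).
Proof.
have tailL m (L0 : 'Hom(H X i, H X m)) : exists e (L : 'Hom(H X i, H X e)),
    forall v, foldl (@hcup k C H U X) (hom_elem (L0 v)) t = hom_elem (L v).
  elim: t m L0 => [|y t IHt] m L0; first by exists m, L0.
  have [L1 L1E] := cup_lfunl m (tagged y).
  have [e [L LE]] := IHt _ (L1 \o L0)%VF; exists e, L => v.
  by rewrite -LE /= comp_lfunE L1E.
case: s => [|x s] /=.
  by have [e [L LE]] := tailL _ \1%VF; exists e, L => v; rewrite -LE id_lfunE.
have [L1 L1E] := cup_lfunr i (tagged (foldl (@hcup k C H U X) x s)).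
have [e [L LE]] := tailL _ L1; exists e, L => v.
by rewrite foldl_cat /= -LE L1E.
Qed.

End Cup.

(** * The cohomology of a power *)

Section Power.
Variables (k : fieldType) (C : category) (P : finite_products C).
Variables (H : grfunctor k C) (U : cup_product H) (HK : kunneth P U).

Lemma lform_rVof (V : vectType k) (th : 'Hom(V, k^o)) v :
  rVof (vbasis {:V}) v *m (\col_i th (vbasis {:V})`_i) = (th v : k)%:M.
Proof.
apply/matrixP => p q; rewrite !ord1 !mxE eqxx mulr1n.
rewrite [in RHS](coord_vbasis (memvf v)) linear_sum; apply: eq_bigr => i _.
by rewrite !mxE linearZ.
Qed.

(** The tensor product of two linear forms, transported to H(X x Y) by the
Kuenneth isomorphism.  On a tensor given by its matrix t with respect to the
bases, it is the bilinear expression (values of th)^T t (values of et). *)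
Lemma kunneth_form (X Y : C) (th : gr_form (H X)) (et : gr_form (H Y)) :
  exists Th : gr_form (H (prod_obj (binprod P X Y))),
    forall i j (a : H X i) (b : H Y j),
      Th (i + j)%N (cup U (pull H (proj1 P X Y) i a) (pull H (proj2 P X Y) j b))
      = th i a * et j b.
Proof.
have [K [_ KE]] := HK X Y.
pose c (Z : C) (f : gr_form (H Z)) i := \col_(p < \dim {:H Z i}) (f i (vbasis {:H Z i})`_p : k).
pose T d (t : gtens (H X) (H Y) d) : k^o :=
  \sum_(i < d.+1) ((c X th i)^T *m t i *m c Y et (d - i)%N) 0 0.
have Tlin d : linear (fun v => T d (K d v)).
  move=> a u v; rewrite linearP scaler_sumr -big_split; apply: eq_bigr => i _ /=.
  by rewrite !ffunE mulmxDr mulmxDl -scalemxAr -scalemxAl !mxE.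
exists (fun d => sval (cid (lfun_ex (Tlin d)))) => i j a b.
rewrite (svalP (cid (lfun_ex (Tlin _)))) KE /T.
have il : (i < (i + j).+1)%N by rewrite ltnS leq_addr.
have pureE (l : 'I_(i + j).+1) :
    ((c X th l)^T *m gtens_pure a b l *m c Y et (i + j - l)%N) 0 0
    = th l (hcomp a l) * et (i + j - l)%N (hcomp b (i + j - l)%N).
  rewrite ffunE /tens_pure !mulmxA -trmx_mul lform_rVof -mulmxA lform_rVof.
  by rewrite tr_scalar_mx mul_scalar_mx mxE mxE eqxx mulr1n.
rewrite (eq_bigr _ (fun l _ => pureE l)) (bigD1 (Ordinal il)) //= hcomp_id.
rewrite big1 ?addr0 => [|l li].
  rewrite -[X in _ * X](hform_hcomp et (x := hom_elem b)) //= .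
  by rewrite addKn.
by rewrite hcomp_neq ?linear0 ?mul0r // eq_sym.
Qed.

(** X^(n+1) is the product of X^n and X, so [kunneth_form] gives the tensor
product of n linear forms by induction. *)
Lemma power_form_exists (X : C) n (n_gt0 : (0 < n)%N) (th : 'I_n -> gr_form (H X)) :
  exists Th : gr_form (H (prod_obj (power P X n))),
    forall a : 'I_n -> helem (H X), hform Th (cross P U a) = \prod_i hform (th i) (a i).
Proof.
case: n n_gt0 th => // n _; elim: n => [|n IHn] th.
  have [s [ps _]] := power1_inv P X.
  exists (fun d => th ord0 d \o pull H s d)%VF => a.
  by rewrite cross1 big_ord1 /hform /= comp_lfunE (pull_inv ps).
have [e [e' [ee' _ crossE]]] := cross_recr P U X n.
have [Th0 Th0E] := IHn (fun i => th (lift ord_max i)).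
have [Th ThE] := kunneth_form Th0 (th ord_max).
exists (fun d => Th d \o pull H e' d)%VF => a.
rewrite crossE /hform /= comp_lfunE (pull_inv ee') ThE.
rewrite (bigD1_ord ord_max) //= mulrC; congr (_ * _).
exact: Th0E.
Qed.

Definition is_basis_elem (V : nat -> vectType k) (x : helem V) : Prop :=
  exists j : 'I_(\dim {:V (tag x)}), tagged x = (vbasis {:V (tag x)})`_j.

(** Expand the factors one after the other; this keeps the cross product in [S]
because it is linear in each factor. *)
Lemma cross_span_basis (X : C) n (n_gt0 : (0 < n)%N)
    (S : forall d, {vspace H (prod_obj (power P X n)) d}) :
  (forall a : 'I_n -> helem (H X), (forall i, is_basis_elem (a i)) ->
     tagged (cross P U a) \in S (tag (cross P U a))) ->
  forall d v, v \in S d.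
Proof.
move=> SB; apply: (cross_span HK n_gt0) => a.
(* l lists the positions where the factor may fail to be a basis element. *)
suff: forall (l : seq 'I_n) a, (forall i, i \notin l -> is_basis_elem (a i)) ->
     tagged (cross P U a) \in S (tag (cross P U a)).
  by move/(_ (enum 'I_n)); apply=> i; rewrite mem_enum.
elim=> [|j l IHl] {}a aB; first by apply: SB => i; apply: aB.
pose upd (v : H X (tag (a j))) i := if i == j then hom_elem v else a i.
have [e [L LE]] : exists e (L : 'Hom(H X (tag (a j)), H (prod_obj (power P X n)) e)),
    forall v, cross P U (upd v) = hom_elem (L v).
  pose pl i := pull H (proj (power P X n) i).
  have := enum_uniq 'I_n; rewrite /cross.
  case/splitPr: (mem_enum 'I_n j : j \in enum 'I_n) => s t un.
  have /andP[js jt] : (j \notin s) && (j \notin t).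
    by move: un; rewrite cat_uniq /= => /and3P[_ /norP[-> _] /andP[-> _]].
  have [e [L LE]] := hcups_lfun U [seq hmap (pl i) (a i) | i <- s]
    [seq hmap (pl i) (a i) | i <- t] (tag (a j)).
  exists e, (L \o pl j _)%VF => v; rewrite comp_lfunE -LE map_cat /=.
  have updE r : j \notin r ->
      [seq hmap (pl i) (upd v i) | i <- r] = [seq hmap (pl i) (a i) | i <- r].
    move=> jr; apply/eq_in_map => i ir; rewrite /upd; case: eqP => // ij.
    by rewrite -ij ir in jr.
  by rewrite !updE // /upd eqxx.
have -> : a = upd (tagged (a j)).
  by apply/funext => i; rewrite /upd; case: eqP => // ->; case: (a j).
rewrite LE /= (coord_vbasis (memvf (tagged (a j)))) linear_sum.
apply: rpred_sum => p _; rewrite linearZ; apply: rpredZ.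
have := IHl (upd (vbasis {:H X (tag (a j))})`_p); rewrite LE; apply => i il.
rewrite /upd; case: eqP => [_|/eqP ij]; first by exists p.
by apply: aB; rewrite inE negb_or ij.
Qed.

Variables (X : C) (n : nat) (n_gt0 : (0 < n)%N).
Local Notation XN := (prod_obj (power P X n)).

Lemma tag_cross (a : 'I_n -> helem (H X)) : tag (cross P U a) = \sum_i tag (a i).
Proof. by rewrite /cross tag_hcups -map_comp sumnE big_map big_enum. Qed.

Section Basis.
Variable d : nat.
Local Notation J := 'I_#|basis_index (H X) d|.
Implicit Types f h : {ffun 'I_n -> J}.

Definition cross_basis f : helem (H XN) := cross P U (fun i => basis_elem (f i)).

Definition cross_form f : gr_form (H XN) :=
  sval (cid (power_form_exists n_gt0 (fun i => dual_form (f i)))).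

Lemma cross_formE f a :
  hform (cross_form f) (cross P U a) = \prod_i hform (dual_form (f i)) (a i).
Proof. exact: (svalP (cid (power_form_exists n_gt0 (fun i => dual_form (f i))))). Qed.

Lemma cross_form_basis f h : hform (cross_form f) (cross_basis h) = (f == h)%:R.
Proof.
rewrite cross_formE; under eq_bigr do rewrite dual_form_basis.
case: eqP => [->|/eqP fh]; first by rewrite big1 // => i _; rewrite eqxx.
have [i fi] : exists i, f i != h i.
  by apply/existsP; apply: contraNT fh => /existsPn fh; apply/eqP/ffunP => i;
     apply/eqP; have := fh i; rewrite negbK.
by rewrite (bigD1 i) //= (negbTE fi) mul0r.
Qed.

(** The forms [cross_form f] and the elements [cross_basis f] are dual to each
other, and the latter span.  In degree [d], an f of another total degree
contributes zero, and all factors of an f of total degree [d] have degree at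
most [d]; hence the finite index set [J]. *)
Lemma cross_basis_expand (v : H XN d) :
  v = \sum_f cross_form f d v *: hcomp (tagged (cross_basis f)) d.
Proof.
(* The spanning argument needs a subspace of each piece, not only of the one of
   degree d: take the kernel of Rf after the projection onto degree d. *)
pose Rf (w : H XN d) := w - \sum_f cross_form f d w *: hcomp (tagged (cross_basis f)) d.
have Rlin m : linear (fun w : H XN m => Rf (hcomp w d)).
  move=> c u w; rewrite hcomp_linear /Rf; set u' := hcomp u d; set w' := hcomp w d.
  rewrite scalerBr addrACA -opprD; congr (_ - _).
  rewrite scaler_sumr -big_split; apply: eq_bigr => f _ /=.
  by rewrite linearP scalerDl scalerA.
pose S m := lker (sval (cid (lfun_ex (Rlin m)))).
have SE m w : (w \in S m) = (Rf (hcomp w d) == 0).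
  by rewrite memv_ker (svalP (cid (lfun_ex (Rlin m)))).
have : v \in S d.
  apply: (cross_span_basis n_gt0) => a aB; rewrite SE.
  have [ad|ad] := eqVneq (tag (cross P U a)) d; last first.
    rewrite hcomp_neq // /Rf big1 ?subr0 // => f _.
    by rewrite linear0 scale0r.
  have [f aE] : exists f, a = fun i => basis_elem (f i).
    have le_d i : (tag (a i) < d.+1)%N.
      by rewrite ltnS -ad tag_cross (bigD1 i) //= leq_addr.
    have f_ex i : exists p : J, a i = basis_elem p.
      have [j aj] := aB i.
      exists (enum_rank (Tagged (fun i : 'I_d.+1 => 'I_(\dim {:H X i})) (i := Ordinal (le_d i)) j)).
      rewrite /basis_elem /idx_deg enum_rankK /= -aj.
      by case: (a i).
    exists [ffun i => sval (cid (f_ex i))]; apply/funext => i.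
    by rewrite ffunE; exact: (svalP (cid (f_ex i))).
  rewrite aE -/(cross_basis f) /Rf (bigD1 f) //= big1 ?addr0 => [|h hf].
    rewrite -(hform_hcomp _ (x := cross_basis f)) ?cross_form_basis ?eqxx ?scale1r ?subrr //.
    by rewrite /cross_basis -aE.
  rewrite -(hform_hcomp _ (x := cross_basis f)) ?cross_form_basis ?(negbTE hf) ?scale0r //.
  by rewrite /cross_basis -aE.
by rewrite SE hcomp_id /Rf subr_eq0 => /eqP.
Qed.

End Basis.
End Power.

(** * The trace of a permutation composed with the induced endomorphism *)

Section PowerTrace.
Variables (k : fieldType) (C : category) (P : finite_products C).
Variables (H : grfunctor k C) (U : cup_product H) (HK : kunneth P U).
Variables (X : C) (n : nat) (n_gt0 : (0 < n)%N) (phi : gr_end (H X)).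
Local Notation XN := (prod_obj (power P X n)).
Local Notation Phi := (power_end HK n_gt0 phi).
Local Notation act g := (pull H (perm_mor P X (g : 'S_n))).

(** Since g sends p_i^* to p_(g i)^*, the factors come out in another order;
putting them back in order costs a Koszul sign. *)
Lemma act_cross (g : 'S_n) d b (a : 'I_n -> helem (H X)) :
    koszul U XN d g b -> (forall i, tag (a (g^-1%g i)) = d i) ->
  hmap (act g) (cross P U a) = hscale ((-1) ^+ b) (cross P U (fun i => a (g^-1%g i))).
Proof.
move=> gb ad; rewrite perm_mor_cross.
rewrite -(gb (fun i => hmap (pull H (proj (power P X n) i)) (a (g^-1%g i)))) //.
by congr (hcups U _); apply: eq_map => i; rewrite permK.
Qed.

(** Phi preserves degrees, hence both sides involve the same Koszul sign. *)
Lemma power_end_act (g : 'S_n) d : (Phi d \o act g d)%VF = (act g d \o Phi d)%VF.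
Proof.
apply: (power_end_uniq HK n_gt0 (Phi := fun d => (Phi d \o act g d)%VF)
  (Psi := fun d => (act g d \o Phi d)%VF)) => a.
have [b gb] := koszul_exists U XN (fun i => tag (a (g^-1%g i))) g.
rewrite !hmap_comp power_endP (act_cross gb) // hmap_scale power_endP.
by rewrite (act_cross gb).
Qed.

(** On X^n, with s_g for [perm_mor P X g], p_i s_g s_h = p_(g i) s_h = p_(h (g i)),
and [(g * h)%g] is g followed by h; pullback reverses the order of s_g and s_h. *)
Lemma act_mul (g h : 'S_n) d : (act h d \o act g d)%VF = act (g * h)%g d.
Proof.
rewrite -pull_comp; congr (pull H _ d); apply: tupling_uniq => i.
by rewrite Defs.compA !proj_tupling permM.
Qed.

(** The identity of the two series at one permutation, compared term by term
over the basis functions f of [cross_basis_expand] and [sum_ffun_orbits]. *)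
Lemma lftrace_act_power_end (g : 'S_n) d :
  (-1) ^+ d * lftrace (act g d \o Phi d)%VF
  = (\prod_(c in porbits g) \sum_p
       (-1) ^+ idx_deg p * (coef_mx d phi ^+ #|c|) p p)`_d.
Proof.
pose x0 := Ordinal n_gt0.
pose rep (c : {set 'I_n}) := odflt x0 [pick x in c].
have repP c : c \in porbits g -> rep c \in c.
  rewrite /rep; case: pickP => //= c0 /imsetP[x _ cE].
  by have := c0 x; rewrite cE porbit_id.
rewrite -(sum_ffun_orbits (coef_mx d phi) (fun p => (-1) ^+ idx_deg p) x0 repP).
rewrite coef_sum (lftrace_dual _ (@cross_basis_expand _ _ _ _ _ HK _ _ n_gt0 d)) mulr_sumr.
apply: eq_bigr => f _.
pose deg i := idx_deg (f i).
have -> : \prod_i coef_mx d phi (f i) (f (g i))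
    = (\prod_i gr_coef phi (f i) (f (g i)))%:P * 'X^(\sum_i deg i).
  by rewrite rmorph_prod -prodrXr -big_split; apply: eq_bigr => i _; rewrite mxE.
have -> : \prod_(c in porbits g) (-1) ^+ idx_deg (f (rep c))
    = (\prod_(c in porbits g) (-1) ^+ deg (rep c))%:P :> {poly k}.
  by rewrite rmorph_prod; apply: eq_bigr => c _; rewrite rmorph_sign.
rewrite !coefCM coefXn.
have tagE : tag (cross_basis P U f) = \sum_i deg i by rewrite tag_cross.
have [dE|dN] := eqVneq d (\sum_i deg i); last first.
  by rewrite hcomp_neq ?tagE 1?eq_sym // !linear0 !mulr0.
have -> : cross_form HK n_gt0 f d ((act g d \o Phi d)%VF (hcomp (tagged (cross_basis P U f)) d))
    = hform (cross_form HK n_gt0 f) (hmap (act g) (hmap Phi (cross_basis P U f))).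
  rewrite -hmap_comp (hform_hcomp _ (m := d)) ?[tag _]tagE //.
  by rewrite [in RHS](hcomp_map (fun d => (act g d \o Phi d)%VF)).
rewrite power_endP mulr1.
have act_b b : koszul U XN (fun i => deg (g^-1%g i)) g b ->
    hform (cross_form HK n_gt0 f) (hmap (act g) (cross P U (fun i => hmap phi (basis_elem (f i)))))
    = (-1) ^+ b * \prod_i gr_coef phi (f i) (f (g i)).
  move=> gb; rewrite (act_cross gb) // hform_scale cross_formE; congr (_ * _).
  by rewrite (reindex_perm g); apply: eq_bigr => i _; rewrite permK.
(* If the degree of f is not constant on the cycles of g, then the Koszul sign
   has no simple expression, but phi has no coefficient between some
   b_(f i) and b_(f (g i)). *)
have [/forallP degg|] := boolP [forall i, deg (g i) == deg i]; last first.
  rewrite negb_forall => /existsP[i gi].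
  have coef0 : \prod_i gr_coef phi (f i) (f (g i)) = 0.
    by rewrite (bigD1 i) //= gr_coef_deg ?mul0r // eq_sym.
  have [b gb] := koszul_exists U XN (fun i => deg (g^-1%g i)) g.
  by rewrite (act_b b gb) coef0 !mulr0.
have {}degg i : deg (g i) = deg i by apply/eqP.
have degV : (fun i => deg (g^-1%g i)) = deg.
  by apply/funext => i; rewrite -{2}(permKV g i) degg.
rewrite (act_b (restr_perm [set i | odd (deg i)] g)); last first.
  by rewrite degV; apply: koszul_stable.
by rewrite mulrA {1}dE (sign_orbits _ degg repP).
Qed.

Lemma invariantsP (G : {group 'S_n}) d v :
  reflect (forall g, g \in G -> act g d v = v) (v \in invariants P H X G d).
Proof.
rewrite /invariants memvE; apply: (iffP subv_bigcapP) => vG g gG.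
  by apply/fixedSpaceP; rewrite memvE vG.
by rewrite -memvE; apply/fixedSpaceP; apply: vG.
Qed.

(** The mean of the operators of G is a projection onto the invariants, so
[lftrace_restrict] applies. *)
Lemma lftrace_invariants (G : {group 'S_n}) d : #|G|%:R != 0 :> k ->
  lftrace (gr_restrict Phi (invariants P H X G) d)
  = #|G|%:R^-1 * \sum_(g in G) lftrace (act g d \o Phi d)%VF.
Proof.
move=> G0; pose Q : 'End(H XN d) := #|G|%:R^-1 *: \sum_(g in G) act g d.
have QE v : Q v = #|G|%:R^-1 *: \sum_(g in G) act g d v by rewrite scale_lfunE sum_lfunE.
rewrite /gr_restrict (lftrace_restrict (Q := Q)).
- rewrite lftrace_comm lftraceE mulr_sumr.
  under [RHS]eq_bigr => g _ do rewrite lftraceE mulr_sumr.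
  rewrite exchange_big /=; apply: eq_bigr => i _.
  rewrite comp_lfunE QE linearZ linear_sum /= mulr_sumr; apply: eq_bigr => g _.
  by rewrite comp_lfunE.
- move=> v; apply/invariantsP => h hG; rewrite QE linearZ linear_sum; congr (_ *: _).
  rewrite [RHS](reindex_inj (mulIg h)) /=.
  apply: eq_big => [g | g _]; first by rewrite groupMr.
  by rewrite -act_mul comp_lfunE.
- move=> u /invariantsP uG; rewrite QE (eq_bigr (fun=> u)) //.
  by rewrite sumr_const -scaler_nat scalerA mulVf // scale1r.
move=> u /invariantsP uG; apply/invariantsP => g gG.
by rewrite -comp_lfunE -power_end_act comp_lfunE uG.
Qed.

End PowerTrace.

Theorem theorem1p4 (k : fieldType) (C : category) (P : finite_products C)
    (H : grfunctor k C) (U : cup_product H) (HK : kunneth P U)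
    (n : nat) (n_gt0 : (0 < n)%N) (G : {group 'S_n})
    (charG : forall p : nat, p \in [pchar k] -> ~~ (p %| #|G|)%N)
    (X : C) (phi : gr_end (H X)) :
  lefschetz (gr_restrict (power_end HK n_gt0 phi) (invariants P H X G))
  = mmap (@fpsC k)
      (fun i : 'I_n => fps_subXn i.+1 (lefschetz (gr_exp phi i.+1)))
      (cycle_index k G).
Proof.
have G0 : #|G|%:R != 0 :> k.
  apply/negP => G0; have [p pk] := natf0_pchar (cardG_gt0 G) G0.
  by have := charG p pk; rewrite (dvdn_pcharf pk) G0.
apply: fpsP => d.
rewrite (mmap_cycle_index G (fun r => fps_subXn r (lefschetz (gr_exp phi r)))).
rewrite fps_coefCM fps_coef_sum /= lftrace_invariants // mulrCA mulr_sumr.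
congr (_ * _); apply: eq_bigr => g _; rewrite lftrace_act_power_end.
apply: esym; apply: (@fps_coef_prod _ _ _ _ _ _ d) => // c cg m md.
apply: fps_coef_supertrace => //.
by case/imsetP: cg => x _ ->; rewrite lt0n card_porbit_neq0.
Qed.
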